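(* Let $B\sim N(0,I_d)$ and $S_n=\sum_{i=1}^n\frac{\xi_i}{\sqrt n}$, where $(\xi_i)_{i\in\mathbb{N}}$ are i.i.d. random vectors in $\mathbb{R}^d$ with $\mathbb{E}\xi_i=0$, $\mathbb{E}\xi_i\xi_i^T=I_d$ and $\sup_i\mathbb{E}|\xi_i|^3<\infty$. Then $$d_W(\mathcal{L}(B),\mathcal{L}(S_n))\le\Big[\big(\tfrac23d+1\big)\mathbb{E}|B|+\tfrac13\mathbb{E}|\xi_1|^3+\mathbb{E}|\xi_1|\Big]n^{-1/2}(1+\ln n).$$
   Context: $d_W(\mu,\nu)=\sup\{|\mathbb{E}h(X)-\mathbb{E}h(Y)|: h:\mathbb{R}^d\to\mathbb{R},\ |h(x)-h(y)|\le|x-y|\}$ with $X\sim\mu$, $Y\sim\nu$. *)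

(* Defs.v *)
(* R^dim is modelled as [dim.-tuple R], which the
   library equips with the product (Borel) sigma-algebra. *)
From HB Require Import structures.
From mathcomp Require Import all_boot all_order all_algebra.
From mathcomp Require Import all_classical all_reals all_analysis.
Set Implicit Arguments. Unset Strict Implicit. Unset Printing Implicit Defensive.
Import Order.TTheory GRing.Theory Num.Theory.
Local Open Scope classical_set_scope.
Local Open Scope ring_scope.

Definition enorm {R : realType} {dim : nat} (x : dim.-tuple R) : R :=
  Num.sqrt (\sum_(j < dim) tnth x j ^+ 2).

Definition edist {R : realType} {dim : nat} (x y : dim.-tuple R) : R :=
  Num.sqrt (\sum_(j < dim) (tnth x j - tnth y j) ^+ 2).

Definition lip1 {R : realType} {dim : nat} : set (dim.-tuple R -> R) :=
  [set h | forall x y, `|h x - h y| <= edist x y].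

Definition dW {R : realType} {dim : nat}
  {d1} {T1 : measurableType d1} (P1 : probability T1 R) (X : T1 -> dim.-tuple R)
  {d2} {T2 : measurableType d2} (P2 : probability T2 R) (Y : T2 -> dim.-tuple R)
  : \bar R :=
  ereal_sup [set (`| 'E_P1[h \o X] - 'E_P2[h \o Y] |)%E | h in lip1].

(* mutual independence of a sequence of random vectors: for every n, the
   family (X_0, ..., X_{n-1}) satisfies the product rule for all measurable
   sets (taking A_i = setT covers every finite subfamily) *)
Definition mutually_independent {R : realType} {dim : nat}
  {d} {T : measurableType d} (P : probability T R)
  (X : nat -> T -> dim.-tuple R) : Prop :=
  forall (n : nat) (A : nat -> set (dim.-tuple R)),
    (forall i, measurable (A i)) ->
    P (\bigcap_(i in `I_n) (X i @^-1` A i)) =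
    (\prod_(i < n) P (X i @^-1` A i))%E.

Definition identically_distributed {R : realType} {dim : nat}
  {d} {T : measurableType d} (P : probability T R)
  (X : nat -> T -> dim.-tuple R) : Prop :=
  forall (i : nat) (A : set (dim.-tuple R)), measurable A ->
    P (X i @^-1` A) = P (X 0%N @^-1` A).

Definition std_gaussian_vector {R : realType} {dim : nat}
  {d} {T : measurableType d} (P : probability T R)
  (B : T -> dim.-tuple R) : Prop :=
  measurable_fun setT B /\
  forall A : 'I_dim -> set R, (forall j, measurable (A j)) ->
    P (\bigcap_(j in setT) ((fun w => tnth (B w) j) @^-1` A j)) =
    (\prod_(j < dim) normal_prob 0 1 (A j))%E.

Definition Snorm {R : realType} {dim : nat} {T : Type}
  (xi : nat -> T -> dim.-tuple R) (n : nat) : T -> dim.-tuple R :=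
  fun w => [tuple (\sum_(i < n) tnth (xi i w) j) / Num.sqrt n%:R | j < dim].

(* Main.v *)
Require Import Defs.
From HB Require Import structures.
From mathcomp Require Import all_boot all_order all_algebra.
From mathcomp Require Import all_classical all_reals all_analysis.
From mathcomp Require Import measurable_realfun.
From mathcomp Require Import zify ring lra.
Import Order.TTheory GRing.Theory Num.Theory.
Import numFieldNormedType.Exports.
(* Re-imported because [edist] is also a name of the analysis library. *)
Import Defs.
Local Open Scope classical_set_scope.
Local Open Scope ring_scope.

Set Implicit Arguments. Unset Strict Implicit. Unset Printing Implicit Defensive.

(** Lindeberg's exchange argument with Gaussian smoothing.  Write [g] for the standard
    Gaussian law, [c = 1/sqrt n], and [u_m x] for the integral of [h (x + sqrt m c y)]
    against [g dy], so that averaging [u_m] over a further step [c y], [y ~ g], gives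
    [u_(m+1)].  Replacing the steps [c xi_k] by Gaussian ones one at a time, the total error
    is at most the sum over [m < n] of the largest difference between the averages of
    [x |-> u_m (x + c v)] over [v ~ xi_0] and over [v ~ g].  For [m = 0] this is at most
    [c (E|xi_0| + E|B|)] as [h] is 1-Lipschitz.  For [m > 0] the Cameron-Martin formula puts
    the dependence on [v] into an exponential; the second-order Taylor polynomial of [u_m]
    integrates to the same value for both laws (equal means and covariances), and shifting
    back and using that [h] is Lipschitz bounds the remainder by [c |v|^3 / (3 m)].  Summing
    gives a harmonic sum, and [E|B|^3 <= (d + 2) E|B|] brings the constants into the stated
    form. *)

(** * Euclidean geometry on tuples and Lipschitz functions *)

(** As [h] is merely Lipschitz, no derivative of it may appear. After Cameron-Martin the expansion
    is in a scalar [s] that scales the shift [v] inside an explicit density. Second derivatives of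
    the density in [s] yield only [|v|^2]; the third power comes from keeping the second derivative
    at [s = 0] inside the remainder. Shifting back turns the difference of second derivatives into
    an increment of [h], at most [s c |v|], times the second Hermite polynomial of a Gaussian
    variable of variance [|v|^2 / m], whose absolute mean is at most twice that variance. Since
    [s (1 - s)] integrates to [1/6] over the unit interval, the constant is [2/6 = 1/3].

    The estimate degenerates at [m = 0], where nothing is smoothed, and its [1/m] growth is the
    source of the logarithm. In dimension one the bound [1 + ln n] of the harmonic sum is too weak
    for the stated constant when [ln n] is small; it is mixed with a second bound by [2 ln n]. *)

Section euclid.
Context {R : realType} {d : nat}.
Implicit Types x y w : d.-tuple R.

Definition tshift (c : R) x y : d.-tuple R :=
  [tuple tnth x j + c * tnth y j | j < d].

Definition dot w y : R := \sum_(j < d) tnth w j * tnth y j.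

Lemma tnth_tshift c x y j : tnth (tshift c x y) j = tnth x j + c * tnth y j.
Proof. by rewrite tnth_mktuple. Qed.

Lemma enorm_ge0 x : 0 <= enorm x.
Proof. exact: sqrtr_ge0. Qed.

Lemma sqr_enorm x : enorm x ^+ 2 = \sum_(j < d) tnth x j ^+ 2.
Proof. by rewrite sqr_sqrtr// sumr_ge0// => j _; exact: sqr_ge0. Qed.

Lemma sqrt_sumM (c : R) (f : 'I_d -> R) :
  Num.sqrt (\sum_(j < d) (c * f j) ^+ 2) =
  `|c| * Num.sqrt (\sum_(j < d) f j ^+ 2).
Proof.
under eq_bigr do rewrite exprMn.
by rewrite -mulr_sumr sqrtrM ?sqr_ge0// sqrtr_sqr.
Qed.

Lemma edist_tshift c x y : edist (tshift c x y) x = `|c| * enorm y.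
Proof.
rewrite -sqrt_sumM; congr Num.sqrt; apply: eq_bigr => j _.
by rewrite tnth_tshift addrAC subrr add0r.
Qed.

Lemma edist_tshiftl c x x' y : edist (tshift c x y) (tshift c x' y) = edist x x'.
Proof.
congr Num.sqrt; apply: eq_bigr => j _.
by rewrite !tnth_tshift opprD addrACA subrr addr0.
Qed.

Lemma tshiftA a x s y w :
  tshift a x (tshift s y w) = tshift (a * s) (tshift a x y) w.
Proof.
by apply: eq_from_tnth => j; rewrite !tnth_tshift mulrDr addrA mulrA.
Qed.

Lemma dot_tshift s y w : dot w (tshift s y w) = dot w y + s * enorm w ^+ 2.
Proof.
rewrite /dot sqr_enorm mulr_sumr -big_split/=; apply: eq_bigr => j _.
by rewrite tnth_tshift; ring.
Qed.

Lemma sqr_tnth_le x j : tnth x j ^+ 2 <= enorm x ^+ 2.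
Proof.
rewrite sqr_enorm (bigD1 j)//= lerDl sumr_ge0// => i _; exact: sqr_ge0.
Qed.

Lemma norm_tnth_le x j : `|tnth x j| <= enorm x.
Proof.
rewrite -(@ler_pXn2r _ 2)// ?nnegrE ?enorm_ge0//.
by rewrite real_normK ?num_real// sqr_tnth_le.
Qed.

(** Cruder than Cauchy-Schwarz, but it only serves to dominate integrands and never reaches the
    final constants. *)
Lemma norm_dot_le w y : `|dot w y| <= (\sum_(j < d) `|tnth w j|) * enorm y.
Proof.
rewrite (le_trans (ler_norm_sum _ _ _))// mulr_suml ler_sum// => j _.
by rewrite normrM ler_wpM2l// norm_tnth_le.
Qed.

Lemma sqr_dot w y :
  dot w y ^+ 2 = \sum_(j < d) \sum_(k < d) (tnth w j * tnth w k) * (tnth y j * tnth y k).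
Proof.
rewrite expr2 {1}/dot mulr_suml; apply: eq_bigr => j _.
by rewrite mulr_sumr; apply: eq_bigr => k _; ring.
Qed.

Lemma edist_le_sum x y : edist x y <= \sum_(j < d) `|tnth x j - tnth y j|.
Proof.
have S0 : 0 <= \sum_(j < d) `|tnth x j - tnth y j| by exact: sumr_ge0.
rewrite -(@ler_pXn2r _ 2)// ?nnegrE ?sqrtr_ge0// sqr_sqrtr; last first.
  by apply: sumr_ge0 => j _; exact: sqr_ge0.
rewrite [leRHS]expr2 mulr_suml ler_sum// => j _.
rewrite -[leLHS]real_normK ?num_real// expr2 ler_wpM2l//.
by rewrite (bigD1 j)//= lerDl sumr_ge0.
Qed.

End euclid.

(** * Measurability of the Euclidean operations *)

Lemma measurable_sqrtr {R : realType} : measurable_fun setT (@Num.sqrt R).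
Proof. by apply: continuous_measurable_fun; exact: sqrt_continuous. Qed.

Lemma measurable_tshift {R : realType} {d : nat} dT (T : measurableType dT)
    (c : T -> R) (f g : T -> d.-tuple R) :
  measurable_fun setT c -> measurable_fun setT f -> measurable_fun setT g ->
  measurable_fun setT (fun t => tshift (c t) (f t) (g t)).
Proof.
move=> mc /measurable_fun_tnthP mf /measurable_fun_tnthP mg.
apply/measurable_fun_tnthP => j.
rewrite (_ : _ \o _ = fun t => tnth (f t) j + c t * tnth (g t) j).
  by apply: measurable_funD; [exact: mf|apply: measurable_funM => //; exact: mg].
by apply/funext => t /=; rewrite tnth_tshift.
Qed.

Lemma measurable_edist {R : realType} {d : nat} dT (T : measurableType dT)
    (f g : T -> d.-tuple R) :
  measurable_fun setT f -> measurable_fun setT g ->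
  measurable_fun setT (fun t => edist (f t) (g t)).
Proof.
move=> /measurable_fun_tnthP mf /measurable_fun_tnthP mg.
apply: (measurableT_comp measurable_sqrtr); apply: measurable_sum => j.
by apply: measurable_funX; apply: measurable_funB; [exact: mf|exact: mg].
Qed.

Lemma measurable_enorm {R : realType} {d : nat} dT (T : measurableType dT)
    (f : T -> d.-tuple R) :
  measurable_fun setT f -> measurable_fun setT (fun t => enorm (f t)).
Proof.
move=> /measurable_fun_tnthP mf.
apply: (measurableT_comp measurable_sqrtr); apply: measurable_sum => j.
by apply: measurable_funX; exact: mf.
Qed.

Lemma measurable_dot {R : realType} {d : nat} dT (T : measurableType dT)
    (w : d.-tuple R) (f : T -> d.-tuple R) :
  measurable_fun setT f -> measurable_fun setT (fun t => dot w (f t)).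
Proof.
move=> /measurable_fun_tnthP mf; apply: measurable_sum => j.
by apply: measurable_funM => //; exact: mf.
Qed.

Section lipschitz.
Context {R : realType} {d : nat}.
Implicit Types (h : d.-tuple R -> R) (x y : d.-tuple R).

Lemma rational_tuple_dense x (e : R) : 0 < e ->
  exists r : d.-tuple rat, edist x [tuple ratr (tnth r j) | j < d] <= e.
Proof.
(* Dividing by [d.+1] instead of [d] covers the empty tuple; the [d] coordinate errors still sum to
   at most [e]. *)
move=> e0; have d0 : 0 < e / d.+1%:R by rewrite divr_gt0.
have near j : exists q : rat, `|tnth x j - ratr q| <= e / d.+1%:R.
  have /rat_in_itvoo[q] : tnth x j < tnth x j + e / d.+1%:R by rewrite ltrDl.
  rewrite in_itv/= => /andP[q1 q2]; exists q.
  by rewrite distrC ger0_norm ?subr_ge0 ?ltW// ltrBlDl.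
have [r rP] := choice near.
exists [tuple r j | j < d]; apply: (le_trans (edist_le_sum _ _)).
apply: (@le_trans _ _ (\sum_(j < d) e / d.+1%:R)).
  by apply: ler_sum => j _; rewrite !tnth_mktuple.
rewrite sumr_const card_ord -[leLHS]mulr_natr -mulrA ler_piMr ?ltW//.
by rewrite ltr_pdivrMl// mulr1 ltr_nat.
Qed.

(* The sublevel sets of [h] are countable unions of open balls with rational centres. *)
Lemma lip1_measurable h : lip1 h -> measurable_fun setT h.
Proof.
move=> hl; apply: (measurability _ (RGenInftyO.measurableE R)) => //.
move=> _ [_ [c ->] <-]; rewrite setTI.
pose t (r : d.-tuple rat) : d.-tuple R := [tuple ratr (tnth r j) | j < d].
rewrite (_ : _ @^-1` _ = \bigcup_r [set x | h (t r) + edist x (t r) < c]); last first.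
  apply/seteqP; split => x /=.
    rewrite in_itv/= => hc.
    (* Both the change of [h] and the distance to the centre are at most this tolerance, so together
       they stay below the gap [c - h x]. *)
    have e0 : 0 < (c - h x) / 3 by lra.
    have [r rP] := rational_tuple_dense x e0.
    exists r => //=; have := hl (t r) x; have -> : edist (t r) x = edist x (t r).
      by congr Num.sqrt; apply: eq_bigr => j _; rewrite -sqrrN opprB.
    rewrite ler_distl => /andP[_]; rewrite /t; lra.
  move=> [r _ /=]; rewrite in_itv/=; apply: le_lt_trans.
  by have := hl x (t r); rewrite ler_distl => /andP[_].
apply: countable_bigcupT_measurable; first exact: countableP.
move=> r; rewrite -[X in measurable X]setTI.
rewrite (_ : [set x | _] = (fun x => h (t r) + edist x (t r)) @^-1` `]-oo, c[); last first.
  by apply/seteqP; split => x /=; rewrite in_itv.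
apply: measurable_funD => //; exact: measurable_edist.
Qed.

Lemma lip1_tshift_le h c x y : lip1 h ->
  `|h (tshift c x y) - h x| <= `|c| * enorm y.
Proof. by move=> hl; rewrite -(edist_tshift c x y); exact: hl. Qed.

Lemma lip1_growth h c x y : lip1 h ->
  `|h (tshift c x y)| <= `|h x| + `|c| * enorm y.
Proof.
move=> hl; rewrite -[h (tshift _ _ _)](subrK (h x)) addrC.
by rewrite (le_trans (ler_normD _ _))// lerD2l lip1_tshift_le.
Qed.

End lipschitz.

(** * The one-dimensional Gaussian law *)

Section gauss1.
Context {R : realType}.
Local Notation mu := (@lebesgue_measure R).
Local Notation N01 := (@normal_prob R 0 1).
Local Notation phi := (@normal_pdf R 0 1).

Lemma normal_pdf01E (x : R) : phi x = normal_peak 1 * expR (- x ^+ 2 / 2).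
Proof.
by rewrite normal_pdfE ?oner_eq0// /normal_fun subr0 expr1n mulr2n.
Qed.

(** The Radon-Nikodym derivative of [N01] agrees with [phi] almost everywhere, since both integrate
    to [N01] over every measurable set. *)
Lemma ge0_integral_normal01 (f : R -> \bar R) :
  measurable_fun setT f -> (forall x, 0 <= f x)%E ->
  (\int[N01]_x f x = \int[mu]_x (f x * (phi x)%:E))%E.
Proof.
move=> mf f0; have dom := normal_prob_dominates (0 : R) 1.
rewrite -(Radon_Nikodym_SigmaFinite.change_of_variables dom)//.
apply: ae_eq_integral => //.
- apply: emeasurable_funM => //.
  exact: measurable_int (Radon_Nikodym_SigmaFinite.f_integrable dom).
- apply: emeasurable_funM => //; apply/measurable_EFinP.
  exact: measurable_normal_pdf.
- apply: ae_eqe_mul2l; apply: integral_ae_eq => //.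
  + exact: Radon_Nikodym_SigmaFinite.f_integrable.
  + by apply/measurable_EFinP; exact: measurable_normal_pdf.
  + by move=> E _ mE; rewrite -Radon_Nikodym_SigmaFinite.f_integral.
Qed.

Lemma measurable_affine (a b : R) : measurable_fun setT (fun x : R => a * x + b).
Proof. by apply: measurable_funD => //; exact: measurable_funM. Qed.

(** Lebesgue measure and [a] times its image under [x |-> a x + b] agree on half-open intervals,
    hence everywhere. *)
Lemma ge0_integral_affine (a b : R) (f : R -> \bar R) : 0 < a ->
  measurable_fun setT f -> (forall x, 0 <= f x)%E ->
  (\int[mu]_x f x = a%:E * \int[mu]_x f (a * x + b)%R)%E.
Proof.
move=> a0 mf f0.
pose g : measurableTypeR R -> measurableTypeR R := fun x => a * x + b.
have mg : measurable_fun setT g by exact: measurable_affine.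
pose m := mscale (NngNum (ltW a0))
  (@measure_function_pushforward__canonical__measure_function_Measure
     _ _ _ _ _ mu g mg).
have mE A : measurable A -> mu A = m A.
  move=> mA; apply: lebesgue_measure_unique => //= _ [[p q]] _ <-.
  rewrite /m /mscale/= /pushforward.
  rewrite (_ : _ @^-1` _ = `](p - b) / a, (q - b) / a]%classic); last first.
    apply/seteqP; split => x /=; rewrite !in_itv/= /g;
    by rewrite ltr_pdivrMr// ler_pdivlMr// ltrBlDr lerBrDr [x * a]mulrC.
  rewrite !lebesgue_measure_itv/= !lte_fin ltr_pM2r ?invr_gt0// ltrD2r.
  case: ifPn => pq; last by rewrite mule0.
  by rewrite -!EFinD -EFinM; congr EFin; field; rewrite gt_eqF.
transitivity (\int[m]_x f x)%E.
  by apply: eq_measure_integral => //= A mA _; exact: mE.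
rewrite ge0_integral_mscale//=; congr (_ * _)%E.
by rewrite ge0_integral_pushforward.
Qed.

(** Substituting [y + s] for [y] on the right leaves the Lebesgue integral unchanged, and completing
    the square gives [phi (y + s) exp (s (y + s) - s^2 / 2) = phi y]. *)
Lemma ge0_cameron_martin1 (s : R) (f : R -> \bar R) :
  measurable_fun setT f -> (forall x, 0 <= f x)%E ->
  (\int[N01]_y f (y + s)%R =
   \int[N01]_y (f y * (expR (s * y - s ^+ 2 / 2))%:E))%E.
Proof.
move=> mf f0.
have mexp : measurable_fun setT (fun y : R => expR (s * y - s ^+ 2 / 2)).
  by apply: measurableT_comp => //; exact: measurable_affine.
rewrite !ge0_integral_normal01//; last 3 first.
- by apply: emeasurable_funM => //; exact/measurable_EFinP.
- by move=> x; apply: mule_ge0 => //; rewrite lee_fin expR_ge0.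
- by apply: (measurableT_comp mf); exact: measurable_funD.
rewrite [RHS](@ge0_integral_affine 1 s)//; last 2 first.
- apply: emeasurable_funM; last first.
    by apply/measurable_EFinP; exact: measurable_normal_pdf.
  by apply: emeasurable_funM => //; exact/measurable_EFinP.
- move=> x; apply: mule_ge0; last by rewrite lee_fin normal_pdf_ge0.
  by apply: mule_ge0 => //; rewrite lee_fin expR_ge0.
rewrite mul1e; apply: eq_integral => y _; rewrite mul1r -muleA; congr (_ * _)%E.
rewrite -EFinM; congr EFin; rewrite !normal_pdf01E mulrCA; congr (_ * _).
by rewrite -expRD; congr expR; field.
Qed.

Lemma ge0_normal01_conv (a b : R) (f : R -> \bar R) : 0 < a -> 0 < b ->
  measurable_fun setT f -> (forall x, 0 <= f x)%E ->
  (\int[N01]_y \int[N01]_z f (a * y + b * z)%R =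
   \int[N01]_y f (Num.sqrt (a ^+ 2 + b ^+ 2) * y)%R)%E.
Proof.
move=> a0 b0 mf f0; set c := Num.sqrt _.
have c0 : 0 < c by rewrite sqrtr_gt0 addr_gt0// exprn_gt0.
have c2 : c ^+ 2 = a ^+ 2 + b ^+ 2 by rewrite sqr_sqrtr// addr_ge0// sqr_ge0.
have mphi := measurable_normal_pdf (0 : R) 1.
have phi0 := normal_pdf_ge0 (0 : R) 1.
have mc : measurable_fun setT (fun y : R => (c * y)%R) by exact: measurable_funM.
have mab : measurable_fun setT (fun p : R * R => (a * p.1 + b * p.2)%R).
  by apply: measurable_funD; apply: measurable_funM.
have mfab : measurable_fun setT (fun p : R * R => f (a * p.1 + b * p.2)%R).
  exact: (measurableT_comp mf).
rewrite (@ge0_integral_normal01 (fun y => f (c * y)%R))//; last first.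
  exact: (measurableT_comp mf).
rewrite ge0_integral_normal01; last 2 first.
- exact: (@measurable_fun_fubini_tonelli_F _ _ _ _ _ N01
    (fun p : R * R => f (a * p.1 + b * p.2)%R)).
- by move=> x; exact: integral_ge0.
(* [k t y] is the joint Lebesgue density of [y] and [t = a y + b z]; integrating out [y] must leave
   the density of [c] times a standard Gaussian. *)
pose k (t y : R) : R := b^-1 * phi (b^-1 * t - b^-1 * a * y) * phi y.
have k0 t y : 0 <= k t y by rewrite /k !mulr_ge0// invr_ge0 ltW.
have mk : measurable_fun setT (fun p : R * R => k p.2 p.1).
  apply: measurable_funM; last by apply: (measurableT_comp mphi).
  apply: measurable_funM => //; apply: (measurableT_comp mphi).
  by apply: measurable_funB; apply: measurable_funM.
have mkt (y : R) (g : R -> R) : measurable_fun setT g ->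
    measurable_fun setT (fun t : R => k (g t) y).
  move=> mg.
  have -> : (fun t : R => k (g t) y) =
    (fun p : R * R => k p.2 p.1) \o (fun t => (y, g t)) by [].
  by apply: measurableT_comp mk _; exact: measurable_fun_pair.
have mky (t : R) : measurable_fun setT (fun y : R => k t y).
  have -> : (fun y : R => k t y) =
    (fun p : R * R => k p.2 p.1) \o (fun y => (y, t)) by [].
  by apply: measurableT_comp mk _; exact: measurable_fun_pair.
transitivity (\int[mu]_y \int[mu]_t (f t * (k t y)%:E))%E.
  apply: eq_integral => y _.
  rewrite ge0_integral_normal01//; last first.
    by apply: (measurableT_comp mf); exact: measurable_funD.
  rewrite [RHS](@ge0_integral_affine b (a * y))//; last 2 first.
  - apply: emeasurable_funM => //; apply/measurable_EFinP.
    exact: (mkt y idfun (@measurable_id _ _ _)).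
  - by move=> x; apply: mule_ge0 => //; rewrite lee_fin.
  rewrite -ge0_integralZl//; last 3 first.
  - apply: emeasurable_funM.
      by apply: (measurableT_comp mf); exact: measurable_affine.
    by apply/measurable_EFinP; apply: mkt; exact: measurable_affine.
  - by move=> x _; apply: mule_ge0 => //; rewrite lee_fin.
  - by rewrite lee_fin ltW.
  rewrite -ge0_integralZr//; last 3 first.
  - apply: emeasurable_funM; last exact/measurable_EFinP.
    by apply: (measurableT_comp mf); exact: measurable_funD.
  - by move=> x _; apply: mule_ge0 => //; rewrite lee_fin.
  - by rewrite lee_fin.
  apply: eq_integral => z _.
  rewrite -muleA [RHS]muleCA [(b * z + _)%R]addrC; congr (_ * _)%E.
  rewrite -!EFinM; congr EFin; rewrite /k.
  rewrite (_ : b^-1 * (a * y + b * z) - b^-1 * a * y = z); last first.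
    by field; rewrite gt_eqF.
  by rewrite !mulrA divff ?gt_eqF// mul1r.
transitivity (\int[mu]_t \int[mu]_y (f t * (k t y)%:E))%E.
  apply: (@fubini_tonelli _ _ _ _ _ mu mu (fun p : R * R => f p.2 * (k p.2 p.1)%:E)%E).
    apply: emeasurable_funM; last exact/measurable_EFinP.
    exact: (measurableT_comp mf).
  by move=> x; apply: mule_ge0 => //; rewrite lee_fin.
rewrite [RHS](@ge0_integral_affine c^-1 0) ?invr_gt0//; last 2 first.
- apply: emeasurable_funM; last exact/measurable_EFinP.
  exact: (measurableT_comp mf).
- by move=> x; apply: mule_ge0 => //; rewrite lee_fin.
rewrite -ge0_integralZl//; last 3 first.
- apply: emeasurable_funM.
    by apply: (measurableT_comp mf); apply: measurable_funM => //; exact: measurable_affine.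
  by apply/measurable_EFinP; apply: (measurableT_comp mphi); exact: measurable_affine.
- by move=> x _; apply: mule_ge0 => //; rewrite lee_fin.
- by rewrite lee_fin invr_ge0 ltW.
apply: eq_integral => t _ /=.
rewrite ge0_integralZl//; last 2 first.
- by apply/measurable_EFinP; exact: mky.
- by move=> x _; rewrite lee_fin.
rewrite addr0 mulrA divff ?gt_eqF// mul1r muleCA; congr (_ * _)%E.
(* The integrand is, up to the factor [c / b], the conditional density of [y] given [t]: Gaussian
   with mean [a t / c^2] and standard deviation [b / c]. *)
have e1 : (1 = (c / b)%:E * \int[mu]_y (phi (c / b * y - a / (b * c) * t))%:E)%E.
  rewrite -(integral_normal_pdf (0 : R) 1).
  rewrite (@ge0_integral_affine (c / b) (- (a / (b * c) * t)))//.
  - by rewrite divr_gt0.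
  - exact/measurable_EFinP.
transitivity ((c^-1 * phi (c^-1 * t))%:E *
   ((c / b)%:E * \int[mu]_y (phi (c / b * y - a / (b * c) * t))%:E))%E; last first.
  by rewrite -e1 mule1 EFinM.
have maff : measurable_fun setT (fun y : R => phi (c / b * y - a / (b * c) * t)).
  by apply: (measurableT_comp mphi); exact: measurable_affine.
rewrite muleA -EFinM -[RHS]ge0_integralZl//; last 3 first.
- exact/measurable_EFinP.
- by move=> x _; rewrite lee_fin.
- by rewrite lee_fin !mulr_ge0// ?invr_ge0 ltW.
apply: eq_integral => y _; rewrite -EFinM; congr EFin; rewrite /k !normal_pdf01E.
set A := expR _; set A' := expR _; set B := expR _; set B' := expR _.
have -> : b^-1 * (normal_peak 1 * A) * (normal_peak 1 * A') =
  b^-1 * normal_peak 1 ^+ 2 * (A * A') by ring.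
rewrite (_ : A * A' = B * B'); first by field; rewrite !gt_eqF.
rewrite /A /A' /B /B' -!expRD; congr expR.
have b2 : b ^+ 2 = c ^+ 2 - a ^+ 2 by rewrite c2 addrAC subrr add0r.
have -> : - (b^-1 * t - b^-1 * a * y) ^+ 2 / 2 + - y ^+ 2 / 2 =
  - (t ^+ 2 - 2 * a * t * y + (a ^+ 2 + b ^+ 2) * y ^+ 2) / (b ^+ 2 * 2).
  by field; rewrite gt_eqF.
have -> : - (c^-1 * t) ^+ 2 / 2 + - (c / b * y - a / (b * c) * t) ^+ 2 / 2 =
  - (b ^+ 2 * t ^+ 2 + (c ^+ 2 * y - a * t) ^+ 2) / (b ^+ 2 * c ^+ 2 * 2).
  by field; rewrite !gt_eqF.
rewrite -c2 b2; field.
by rewrite !gt_eqF//= -b2 exprn_gt0.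
Qed.

End gauss1.

(** * Integration of parameter-dependent functions *)

Section exppoly.
Context {R : realType}.
Implicit Types p q r : {poly R}.
Local Notation mu := (@lebesgue_measure R).

Let G p q r (s : R) : R := p.[s] * expR q.[s] + r.[s].

Lemma is_derive_exppoly p q r (s : R) :
  is_derive s 1 (G p q r) (G (p^`() + p * q^`()) q r^`() s).
Proof.
have dp := is_derive_poly p s.
have dr := is_derive_poly r s.
have de : is_derive s 1 (expR \o horner q) (expR q.[s] * q^`().[s]).
  have dq := is_derive_poly q s.
  exact: is_derive1_comp.
have dpe := is_deriveM dp de.
have := is_deriveD dpe dr.
rewrite (_ : _ + horner r = G p q r); last by apply/funext.
move=> H; apply: (is_derive_eq H).
rewrite /G hornerD hornerM.
transitivity (p.[s] * (expR q.[s] * q^`().[s]) + expR q.[s] * p^`().[s] + r^`().[s]).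
  by [].
by ring.
Qed.

(** The functions [p exp q + r] are closed under differentiation, and Gaussian shift densities have
    this form in the shift parameter. This one formula therefore evaluates every integral over [s]
    needed for the Stein identity and the Taylor remainder. *)
Lemma exppoly_FTC p q r :
  (\int[mu]_(s in `[0%R, 1%R])
     ((p^`() + p * q^`()).[s] * expR q.[s] + r^`().[s])%:E =
   ((p.[1] * expR q.[1] + r.[1]) - (p.[0] * expR q.[0] + r.[0]))%:E)%E.
Proof.
have drv p' r' s : derivable (G p' q r') s 1.
  by have [] := is_derive_exppoly p' q r' s.
have cont p' r' : continuous (G p' q r').
  by move=> s; apply: differentiable_continuous; apply/derivable1_diffP.
rewrite (@continuous_FTC2 _ _ (G p q r))//.
- by apply: continuous_subspaceT; exact: (cont (p^`() + p * q^`()) r^`()).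
- split => //.
  + by apply: cvg_at_right_filter; exact: cont.
  + by apply: cvg_at_left_filter; exact: cont.
- move=> s _; rewrite derive1E.
  by have [_ ->] := is_derive_exppoly p q r s.
Qed.

End exppoly.

Section fubini01.
Context {R : realType} dT (T : measurableType dT) (P : probability T R).
Local Notation mu := (@lebesgue_measure R).
Local Open Scope ereal_scope.

Variables (g' : R -> T -> R) (g : T -> R) (M : R).
Hypothesis mg' : measurable_fun setT (fun p : R * T => g' p.1 p.2).
Hypothesis g'M : forall s, (0 <= s <= 1)%R -> \int[P]_t `|g' s t|%:E <= M%:E.
Hypothesis FTC : forall t, \int[mu]_(s in `[0%R, 1%R]) (g' s t)%:E = (g t)%:E.

Let I01 : set R := `[0%R, 1%R]%classic.
(** Extending by zero off the unit interval puts Fubini on the whole product space; the uniform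
    bound [M] makes the extension integrable. *)
Let F (p : R * T) := (\1_I01 p.1 * g' p.1 p.2)%:E.

Let F_s s : \int[P]_t F (s, t) = ((fun s => \int[P]_t (g' s t)%:E) \_ I01) s.
Proof.
rewrite /F patchE/= indicE; case: ifPn => _.
  by under eq_integral do rewrite mul1r.
by under eq_integral do rewrite mul0r; rewrite integral0.
Qed.

Let iF : (mu \x P).-integrable setT F.
Proof.
have mF : measurable_fun setT F.
  apply/measurable_EFinP; apply: measurable_funM => //.
  have mI : measurable_fun setT (\1_I01 : R -> R).
    by apply: measurable_indic; exact: measurable_itv.
  exact: (measurableT_comp mI).
apply/integrable12ltyP => //.
apply: (@le_lt_trans _ _ (\int[mu]_(s in `[0%R, 1%R]) M%:E)); last first.
  by rewrite integral_cst//= lebesgue_measure_itv/= lte01 oppr0 adde0 mule1 ltry.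
rewrite [leRHS]integral_mkcond; apply: ge0_le_integral => //.
- by move=> x _; exact: integral_ge0.
- apply: (@measurable_fun_fubini_tonelli_F _ _ _ _ _ P (fun p => `|F p|)) => //.
  exact: measurableT_comp.
- by apply/(measurable_restrictT _ _).1 => //; exact: measurable_cst.
- move=> s _; rewrite patchE /F/= indicE -/I01; case: ifPn => s01.
    under eq_integral do rewrite mul1r.
    by apply: g'M; move: s01; rewrite inE /I01/= in_itv.
  by under eq_integral do rewrite mul0r normr0; rewrite integral0.
Qed.

Lemma fubini01 :
  \int[mu]_(s in `[0%R, 1%R]) \int[P]_t (g' s t)%:E = \int[P]_t (g t)%:E.
Proof.
have F_t t : \int[mu]_s F (s, t) = (g t)%:E.
  rewrite -FTC [RHS]integral_mkcond; apply: eq_integral => s _.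
  by rewrite /F patchE/= indicE -/I01; case: ifPn => _; rewrite ?mul1r ?mul0r.
transitivity (\int[mu]_s \int[P]_t F (s, t)).
  by rewrite [LHS]integral_mkcond; apply: eq_integral => s _; rewrite F_s.
by rewrite (Fubini iF); apply: eq_integral => t _; exact: F_t.
Qed.

(** The bound [k] is on the absolute value of the mean, not on the mean of the absolute value:
    cancellation at fixed [s], such as a Cameron-Martin shift reveals, can still be exploited after
    the exchange of integrals. *)
Lemma fubini01_le (k : R -> R) : measurable_fun setT k ->
  (forall s, (0 <= s <= 1)%R -> `|\int[P]_t (g' s t)%:E| <= (k s)%:E) ->
  `|\int[P]_t (g t)%:E| <= \int[mu]_(s in `[0%R, 1%R]) (k s)%:E.
Proof.
move=> mk gk; rewrite -fubini01.
have mphi : measurable_fun I01 (fun s => \int[P]_t (g' s t)%:E).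
  apply/(@measurable_restrictT _ _ _ _ I01); first exact: measurable_itv.
  rewrite (_ : _ \_ _ = fubini_F P F); last by apply/funext => s; rewrite -F_s.
  exact: (measurable_fubini_F iF).
apply: (le_trans (le_abse_integral _ _ _)) => //.
apply: ge0_le_integral => //.
- exact: measurableT_comp.
- by apply/measurable_funTS/measurable_EFinP.
Qed.

End fubini01.

Section weighted_transfer.
Local Open Scope ereal_scope.
Context {R : realType} d1 d2 d3 (T1 : measurableType d1) (T2 : measurableType d2)
  (T : measurableType d3).

(** Positive and negative parts commute with composition and with a nonnegative weight, so the two
    halves of the integral transfer separately, whether finite or not. *)
Lemma signed_transfer (m1 : {measure set T1 -> \bar R})
    (m2 : {measure set T2 -> \bar R}) (phi : T1 -> T) (psi : T2 -> T) (w : T2 -> R) :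
  (forall y, 0 <= w y)%R ->
  (forall f : T -> \bar R, measurable_fun setT f -> (forall y, 0 <= f y) ->
     \int[m1]_x f (phi x) = \int[m2]_y (f (psi y) * (w y)%:E)) ->
  forall f : T -> \bar R, measurable_fun setT f ->
     \int[m1]_x f (phi x) = \int[m2]_y (f (psi y) * (w y)%:E).
Proof.
move=> w0 ge0E f mf; rewrite [LHS]integralE [RHS]integralE; congr (_ - _).
- have -> : (fun x => f (phi x))^\+ = fun x => f^\+ (phi x) by exact: funepos_comp.
  rewrite ge0E//; last exact: measurable_funepos.
  by apply: eq_integral => y _; rewrite !funeposE maxe_pMl ?lee_fin// mul0e.
- have -> : (fun x => f (phi x))^\- = fun x => f^\- (phi x) by exact: funeneg_comp.
  rewrite ge0E//; last exact: measurable_funeneg.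
  apply: eq_integral => y _.
  by rewrite !funenegE maxe_pMl ?lee_fin// mul0e mulNe.
Qed.

End weighted_transfer.

Section probability_integrals.
Context {R : realType} dT (T : measurableType dT) (P : probability T R).
Local Open Scope ereal_scope.
Implicit Types f g : T -> R.

Lemma ge0_integrable f (u : R) : measurable_fun setT f -> (forall t, 0 <= f t)%R ->
  \int[P]_t (f t)%:E <= u%:E -> P.-integrable setT (EFin \o f).
Proof.
move=> mf f0 fu; apply/integrableP; split; first exact/measurable_EFinP.
under eq_integral do rewrite /= ger0_norm//.
by rewrite (le_lt_trans fu)// ltry.
Qed.

Lemma integrable_cst (a : R) : P.-integrable setT (EFin \o (fun=> a)).
Proof. exact: finite_measure_integrable_cst. Qed.

Lemma integrable_le f g : measurable_fun setT f ->
  P.-integrable setT (EFin \o g) -> (forall t, `|f t| <= g t)%R ->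
  P.-integrable setT (EFin \o f).
Proof.
move=> mf ig fg; apply: le_integrable ig => //; first exact/measurable_EFinP.
by move=> t _ /=; rewrite lee_fin (le_trans (fg t))// ler_norm.
Qed.

Lemma integrable_addr f g : P.-integrable setT (EFin \o f) ->
  P.-integrable setT (EFin \o g) -> P.-integrable setT (EFin \o (fun t => f t + g t)%R).
Proof.
move=> fi gi; have := integrableD measurableT fi gi.
by apply: eq_integrable => // t _ /=; rewrite EFinD.
Qed.

Lemma integrable_scale (k : R) f : P.-integrable setT (EFin \o f) ->
  P.-integrable setT (EFin \o (fun t => k * f t)%R).
Proof.
move=> fi; have := integrableZl measurableT k fi.
by apply: eq_integrable => // t _ /=; rewrite EFinM.
Qed.

Lemma integrable_bigsum (I : Type) (s : seq I) (f : I -> T -> R) :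
  (forall i, P.-integrable setT (EFin \o f i)) ->
  P.-integrable setT (EFin \o (fun t => \sum_(i <- s) f i t)%R).
Proof.
move=> fi; have := @integrable_sum _ _ _ P _ measurableT _ s xpredT (fun i => EFin \o f i) (fun i _ => fi i).
by apply: eq_integrable => // t _ /=; rewrite sumEFin.
Qed.

Lemma integral_lin2 f g (a b c u v : R) :
  P.-integrable setT (EFin \o f) -> P.-integrable setT (EFin \o g) ->
  \int[P]_t (f t)%:E = u%:E -> \int[P]_t (g t)%:E = v%:E ->
  \int[P]_t (a + b * f t + c * g t)%:E = (a + b * u + c * v)%:E.
Proof.
move=> fi gi fu gv.
have bi := integrable_scale b fi; have ci := integrable_scale c gi.
have ai := integrable_cst a; have abi := integrable_addr ai bi.
under eq_integral do rewrite EFinD.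
rewrite integralD//=.
under eq_integral do rewrite EFinD.
rewrite integralD//= integral_cst//= probability_setT mule1.
under eq_integral do rewrite EFinM.
rewrite integralZl//= fu.
under eq_integral do rewrite EFinM.
by rewrite integralZl//= gv.
Qed.

End probability_integrals.

(** * Exponential and polynomial moments of the one-dimensional Gaussian law *)

Section normal_moments.
Context {R : realType}.
Local Notation mu := (@lebesgue_measure R).
Local Notation N01 := (@normal_prob R 0 1).
Local Open Scope ereal_scope.

Lemma cameron_martin1 (s : R) (f : R -> \bar R) : measurable_fun setT f ->
  \int[N01]_y f (y + s)%R =
  \int[N01]_y (f y * (expR (s * y - s ^+ 2 / 2))%:E).
Proof.
apply: (@signed_transfer _ _ _ _ _ _ _ N01 N01 (fun y : R => y + s)%R id
  (fun y => expR (s * y - s ^+ 2 / 2))).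
- by move=> y; exact: expR_ge0.
- by move=> g mg g0; exact: ge0_cameron_martin1.
Qed.

(** Cameron-Martin applied to the constant 1 says that [exp (s y - s^2 / 2)] has mean one. *)
Lemma normal01_mgf (s : R) : \int[N01]_y (expR (s * y))%:E = (expR (s ^+ 2 / 2))%:E.
Proof.
have mexp : measurable_fun setT (fun y : R => expR (s * y - s ^+ 2 / 2)).
  by apply: measurableT_comp => //; exact: measurable_affine.
transitivity (\int[N01]_y ((expR (s ^+ 2 / 2))%:E * (expR (s * y - s ^+ 2 / 2))%:E)).
  by apply: eq_integral => y _; rewrite -EFinM -expRD addrC subrK.
rewrite ge0_integralZl//; last exact/measurable_EFinP.
rewrite -[RHS]mule1; congr (_ * _).
have := @cameron_martin1 s (cst 1) (measurable_cst _).
rewrite integral_cst//= probability_setT mule1 => ->.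
by apply: eq_integral => y _; rewrite mul1e.
Qed.

(** A single term of the exponential series bounds [|y|^n / n!] by [exp |y|]. The right-hand side
    has finite Gaussian mean, which yields all polynomial moments. *)
Lemma pow_le_expR n (y : R) :
  (`|y ^+ n| <= n`!%:R * (expR (1 * y) + expR (-1 * y)))%R.
Proof.
apply: (@le_trans _ _ (n`!%:R * expR `|y|)%R).
  rewrite normrX mulrC -ler_pdivrMr ?ltr0n ?fact_gt0//.
  case: n => [|n]; first by rewrite expr0 fact0 divr1 -[leLHS]expR0 ler_expR.
  by rewrite (le_trans _ (expR_ge1Dxn n (normr_ge0 y)))// lerDr.
rewrite ler_wpM2l// mul1r mulN1r.
by have [y0|y0] := ger0P y; rewrite ?lerDl ?lerDr expR_ge0.
Qed.

Lemma normal01_integrableX n : N01.-integrable setT (EFin \o (fun y : R => y ^+ n)%R).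
Proof.
have iexp (s : R) : N01.-integrable setT (EFin \o (fun y => expR (s * y))).
  apply: (@ge0_integrable _ _ _ N01 _ (expR (s ^+ 2 / 2))).
  - by apply: measurableT_comp => //; exact: measurable_funM.
  - by move=> y; exact: expR_ge0.
  - by rewrite normal01_mgf.
apply: (@integrable_le _ _ _ N01 _
  (fun y => n`!%:R * (expR (1 * y) + expR (-1 * y)))%R).
- exact: measurable_funX.
- by apply: integrable_scale; exact: integrable_addr.
- exact: pow_le_expR.
Qed.

Lemma normal01_integrable_poly (p : {poly R}) :
  N01.-integrable setT (EFin \o (fun y : R => p.[y])).
Proof.
rewrite (_ : (fun y : R => p.[y]) = fun y => \sum_(i < size p) p`_i * y ^+ i)%R; last first.
  by apply/funext => y; exact: horner_coef.
apply: integrable_bigsum => i; apply: integrable_scale.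
exact: normal01_integrableX.
Qed.

Lemma measurable_horner (p : {poly R}) : measurable_fun setT (fun y : R => p.[y]).
Proof.
have /measurable_int := normal01_integrable_poly p.
by move/measurable_EFinP.
Qed.

(* By Cameron-Martin the integral of [p (y - s) exp (s y - s^2 / 2)] does not depend on
   [s], nor does that of its [s]-derivative; hence the latter integral vanishes. *)
Lemma normal01_stein (p : {poly R}) :
  \int[N01]_y (('X * p - p^`()).[y])%:E = 0.
Proof.
pose q := ('X * p - p^`())%R.
pose E (s y : R) := expR (s * y - s ^+ 2 / 2).
pose g' (s y : R) := (q.[y - s] * E s y)%R.
pose g (y : R) := (p.[y - 1] * E 1 y - p.[y])%R.
have mq := measurable_horner q.
have mE : measurable_fun setT (fun z : R * R => E z.1 z.2).
  apply: measurableT_comp => //; apply: measurable_funB.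
    exact: measurable_funM.
  by apply: measurable_funM => //; exact: measurable_funX.
have mg' : measurable_fun setT (fun z : R * R => g' z.1 z.2).
  apply: measurable_funM => //.
  by apply: (measurableT_comp mq); exact: measurable_funB.
have shift (F : R -> R) s : measurable_fun setT F ->
    \int[N01]_y (F (y - s) * E s y)%:E = \int[N01]_y (F y)%:E.
  move=> mF; have := @cameron_martin1 s (fun y => (F (y - s)%R)%:E).
  have -> : \int[N01]_y (F (y + s - s))%:E = \int[N01]_y (F y)%:E.
    by apply: eq_integral => y _; rewrite addrK.
  move=> ->; first by [].
  by apply/measurable_EFinP; apply: (measurableT_comp mF); exact: measurable_funB.
have FTC y : \int[mu]_(s in `[0%R, 1%R]) (g' s y)%:E = (g y)%:E.
  (* For fixed [y], these are [p (y - s)] and the exponent of [E s y] as polynomials in [s]; the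
     derivative of [p1 exp q1] is [q (y - s) E s y]. *)
  pose p1 := (p \Po (y%:P - 'X))%R; pose q1 : {poly R} := (y *: 'X - 2^-1 *: 'X^2)%R.
  have p1E s : (p1.[s] = p.[y - s])%R by rewrite horner_comp hornerD hornerN hornerC hornerX.
  have q1E s : q1.[s] = (s * y - s ^+ 2 / 2)%R.
    by rewrite hornerD hornerN !hornerZ hornerX hornerXn; ring.
  have p1'E s : (p1^`().[s] = - p^`().[y - s])%R.
    rewrite deriv_comp hornerM horner_comp derivD derivN derivC derivX add0r.
    by rewrite !(hornerD, hornerN, hornerC, hornerX) mulrN1.
  have q1'E s : (q1^`().[s] = y - s)%R.
    rewrite derivD derivN !derivZ derivX derivXn hornerD hornerN !hornerZ hornerC.
    by rewrite hornerMn hornerXn expr1; field.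
  have := exppoly_FTC p1 q1 0; rewrite !p1E !q1E !horner0 !addr0 subr0.
  have -> : (0 * y - 0 ^+ 2 / 2 = 0 :> R)%R by ring.
  rewrite expR0 mulr1 -/(E 1%R y) -/(g y) => <-; apply: eq_integral => s _; congr EFin.
  rewrite derivC horner0 addr0 hornerD hornerM p1'E q1'E q1E p1E /g'.
  rewrite /q !(hornerD, hornerN, hornerM, hornerX); congr (_ * _)%R; ring.
have -> : 0 = \int[N01]_y (g y)%:E.
  have pi := normal01_integrable_poly p.
  have mp := measurable_horner p.
  have Epi : N01.-integrable setT (EFin \o (fun y => p.[y - 1] * E 1 y)%R).
    apply/integrableP; split.
      apply/measurable_EFinP; apply: measurable_funM.
        by apply: (measurableT_comp mp); exact: measurable_funB.
      have -> : E 1%R = (fun z : R * R => E z.1 z.2) \o (fun y => (1%R, y)) by [].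
      by apply: measurableT_comp mE _; exact: measurable_fun_pair.
    have /integrableP[_] := pi; apply: le_lt_trans.
    rewrite -(shift (fun y => `|p.[y]|)%R 1%R); last exact: measurableT_comp.
    by rewrite le_eqVlt; apply/orP; left; apply/eqP; apply: eq_integral => y _;
      rewrite /= normrM (ger0_norm (expR_ge0 _)).
  under eq_integral do rewrite EFinB.
  by rewrite integralB// shift// subee// integrable_fin_num.
have qi := normal01_integrable_poly q.
have /integrableP[_ qoo] := qi.
have q0 : 0 <= \int[N01]_y `|(EFin \o (fun y : R => q.[y])) y| by exact: integral_ge0.
(* The shift identity applied to [|q|] makes the absolute integral of [g' s] the same for every [s],
   which supplies the uniform bound. *)
rewrite -(@fubini01 _ _ _ N01 g' g (fine (\int[N01]_y `|(EFin \o (fun y : R => q.[y])) y|)))//.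
- transitivity (\int[mu]_(s in `[0%R, 1%R]) \int[N01]_y (q.[y])%:E); last first.
    by apply: eq_integral => s _; rewrite -(shift _ s mq).
  have fin : \int[N01]_y (q.[y])%:E \is a fin_num by exact: integrable_fin_num.
  by rewrite -(fineK fin) integral_cst//= lebesgue_measure_itv/= lte01 oppr0 adde0 mule1.
- move=> s _; rewrite fineK ?ge0_fin_numE//.
  rewrite -(shift (fun y => `|q.[y]|)%R s); last exact: measurableT_comp.
  by rewrite le_eqVlt; apply/orP; left; apply/eqP; apply: eq_integral => y _;
    rewrite /= normrM (ger0_norm (expR_ge0 _)).
Qed.

Lemma normal01_mean : \int[N01]_y y%:E = 0.
Proof.
rewrite -[RHS](normal01_stein 1%R%:P); apply: eq_integral => y _; congr EFin.
by rewrite derivC subr0 hornerM hornerX hornerC mulr1.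
Qed.

Lemma normal01_second_moment : \int[N01]_y (y ^+ 2)%:E = 1.
Proof.
have := normal01_stein 'X.
have iX := normal01_integrableX 2.
have -> : \int[N01]_y ('X * 'X - ('X)^`()).[y]%:E =
    \int[N01]_y (-1 + 1 * y ^+ 2 + 0 * y ^+ 2)%:E.
  apply: eq_integral => y _; congr EFin.
  by rewrite derivX !(hornerD, hornerN, hornerM, hornerX, hornerC); ring.
have fin : \int[N01]_y (y ^+ 2)%:E \is a fin_num by exact: integrable_fin_num.
rewrite -(fineK fin) (@integral_lin2 _ _ _ _ _ _ (-1) 1 0 _ _ iX iX (esym (fineK fin)) (esym (fineK fin))).
by move=> [] H; congr EFin; lra.
Qed.

Lemma normal01_fourth_moment : \int[N01]_y (y ^+ 4)%:E = 3%:E.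
Proof.
have := normal01_stein 'X^3.
have iX := normal01_integrableX 2; have iX4 := normal01_integrableX 4.
have -> : \int[N01]_y ('X * 'X^3 - ('X^3)^`()).[y]%:E =
    \int[N01]_y (0 + 1 * y ^+ 4 + -3 * y ^+ 2)%:E.
  apply: eq_integral => y _; congr EFin.
  by rewrite derivXn !(hornerD, hornerN, hornerM, hornerX, hornerXn, hornerMn); ring.
have fin : \int[N01]_y (y ^+ 4)%:E \is a fin_num by exact: integrable_fin_num.
rewrite -(fineK fin) (@integral_lin2 _ _ _ _ _ _ 0 1 (-3) _ _ iX4 iX (esym (fineK fin)) normal01_second_moment).
by move=> [] H; congr EFin; lra.
Qed.

End normal_moments.

(** * The standard Gaussian law on tuples *)

Section gauss.
Context {R : realType}.
Local Notation N01 := (@normal_prob R 0 1).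
Local Open Scope ereal_scope.

Definition tcons d (p : R * d.-tuple R) : d.+1.-tuple R := [tuple of p.1 :: p.2].

Lemma measurable_tcons d : measurable_fun setT (@tcons d).
Proof. exact: measurable_cons. Qed.

Let tcons' d : measurableTypeR R * d.-tuple R -> d.+1.-tuple R := @tcons d.

HB.instance Definition _ d :=
  isMeasurableFun.Build _ _ _ _ (@tcons' d) (@measurable_tcons d).

Definition tcons_mfun d : {mfun (measurableTypeR R * d.-tuple R)%type >-> (d.+1.-tuple R)} :=
  @tcons' d.

Lemma tnth_tcons0 d p : tnth (@tcons d p) ord0 = p.1.
Proof. by []. Qed.

Lemma tnth_tconsS d p j : tnth (@tcons d p) (lift ord0 j) = tnth p.2 j.
Proof. exact: tnthS. Qed.

Lemma tshift_tcons d (c x y : R) (t u : d.-tuple R) :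
  tshift c (tcons (x, t)) (tcons (y, u)) = tcons ((x + c * y)%R, tshift c t u).
Proof.
apply: eq_from_tnth => j; rewrite tnth_tshift.
have [k ->|->] := unliftP ord0 j; last by rewrite !tnth_tcons0.
by rewrite !tnth_tconsS tnth_tshift.
Qed.

Lemma tconsE d (w : d.+1.-tuple R) : w = tcons (thead w, [tuple of behead w]).
Proof. exact: tuple_eta. Qed.

Lemma enorm_tcons d x (t : d.-tuple R) :
  (enorm (tcons (x, t)) ^+ 2 = x ^+ 2 + enorm t ^+ 2)%R.
Proof.
rewrite !sqr_enorm big_ord_recl tnth_tcons0; congr (_ + _)%R.
by apply: eq_bigr => j _; rewrite tnth_tconsS.
Qed.

Lemma dot_tcons d x y (t u : d.-tuple R) :
  (dot (tcons (x, t)) (tcons (y, u)) = x * y + dot t u)%R.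
Proof.
rewrite /dot big_ord_recl !tnth_tcons0; congr (_ + _)%R.
by apply: eq_bigr => j _; rewrite !tnth_tconsS.
Qed.

(** Recursion on the dimension as a product law lets multidimensional identities follow from the
    one-dimensional ones by induction and Tonelli; dimension zero is the unit mass at the empty
    tuple. *)
Fixpoint gauss (d : nat) : probability (d.-tuple R) R :=
  match d with
  | 0 => \d_ ([tuple] : 0.-tuple R)
  | d'.+1 => distribution (N01 \x gauss d') (tcons_mfun d')
  end.

Lemma gauss0E (f : 0.-tuple R -> \bar R) : measurable_fun setT f ->
  \int[gauss 0]_t f t = f [tuple].
Proof. by move=> mf; rewrite /= integral_dirac// diracT mul1e. Qed.

Lemma measurable_comp_tcons d dU (U : measurableType dU) (f : d.+1.-tuple R -> U) :
  measurable_fun setT f -> measurable_fun setT (fun p => f (tcons p)).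
Proof. by move=> mf; apply: (measurableT_comp mf); exact: measurable_tcons. Qed.

Lemma ge0_gaussSE d (f : d.+1.-tuple R -> \bar R) : measurable_fun setT f ->
  (forall t, 0 <= f t) ->
  \int[gauss d.+1]_t f t = \int[N01]_x \int[gauss d]_t f (tcons (x, t)).
Proof.
move=> mf f0; rewrite /= ge0_integral_distribution//.
by rewrite fubini_tonelli1//; [exact: (measurable_comp_tcons mf)|move=> x; exact: f0].
Qed.

Lemma gaussSE d (f : d.+1.-tuple R -> \bar R) :
  (gauss d.+1).-integrable setT f ->
  \int[gauss d.+1]_t f t = \int[N01]_x \int[gauss d]_t f (tcons (x, t)).
Proof.
move=> fi; have mf := measurable_int _ fi.
have mfc := measurable_comp_tcons mf.
have fci : (N01 \x gauss d).-integrable setT (f \o @tcons d).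
  apply/integrableP; split => //.
  have /integrableP[_] := fi.
  rewrite /= ge0_integral_distribution//; exact: measurableT_comp.
rewrite [LHS](integral_distribution (X := tcons_mfun d))//.
exact: (esym (integral12_prod_meas1 fci)).
Qed.

Lemma gauss_rect d (A : 'I_d -> set R) : (forall j, measurable (A j)) ->
  gauss d [set t | forall j, A j (tnth t j)] = \prod_(j < d) N01 (A j).
Proof.
elim: d A => [|d IH] A mA.
  by rewrite big_ord0 /= diracE mem_set//= => -[].
rewrite big_ord_recl -IH//.
have mA' : measurable [set t : d.-tuple R | forall j, A (lift ord0 j) (tnth t j)].
  have -> : [set t : d.-tuple R | forall j, A (lift ord0 j) (tnth t j)] =
      \big[setI/setT]_(j < d) ((fun t => tnth t j) @^-1` A (lift ord0 j)).
    rewrite -bigcap_seq; apply/seteqP; split => t /= H j; first by move=> _; exact: H.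
    by apply: H => /=; rewrite mem_index_enum.
  apply: bigsetI_measurable => j _; rewrite -[X in measurable X]setTI.
  exact: measurable_tnth.
rewrite -product_measure1E//; last exact: mA.
apply: (congr1 (N01 \x gauss d)).
apply/seteqP; split => -[x t] /=.
  move=> H; split; first exact: (H ord0).
  by move=> j; have := H (lift ord0 j); rewrite tnth_tconsS.
move=> [H0 H1] j; have [k ->|->] := unliftP ord0 j; last by rewrite tnth_tcons0.
by rewrite tnth_tconsS; exact: H1.
Qed.

(** Boxes are stable under intersection and generate the product sigma-algebra: a cylinder over one
    coordinate is a box whose other sides are full. *)
Lemma tuple_measure_unique d (m1 m2 : probability (d.-tuple R) R) :
  (forall A : 'I_d -> set R, (forall j, measurable (A j)) ->
    m1 [set t | forall j, A j (tnth t j)] = m2 [set t | forall j, A j (tnth t j)]) ->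
  forall A, measurable A -> m1 A = m2 A.
Proof.
move=> m12 A mA.
pose G : set (set (d.-tuple R)) := [set X | exists2 A : 'I_d -> set R,
  (forall j, measurable (A j)) & X = [set t | forall j, A j (tnth t j)]].
have GT : G setT by exists (fun=> setT) => //; apply/seteqP; split.
apply: (measure_unique G (fun=> setT)) => //.
- apply/seteqP; split; last first.
    apply: smallest_sub; first exact: sigma_algebra_measurable.
    move=> _ [B mB ->].
    have -> : [set t : d.-tuple R | forall j, B j (tnth t j)] =
        \big[setI/setT]_(j < d) ((fun t => tnth t j) @^-1` B j).
      rewrite -bigcap_seq; apply/seteqP; split => t /= H j; first by move=> _; exact: H.
      by apply: H => /=; rewrite mem_index_enum.
    apply: bigsetI_measurable => j _; rewrite -[X in measurable X]setTI.
    exact: measurable_tnth.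
  apply: smallest_sub; first exact: smallest_sigma_algebra.
  rewrite -bigcup_seq => X [j _ [Y mY <-]]; rewrite setTI.
  apply: sub_sigma_algebra; exists (fun i => if i == j then Y else setT).
    by move=> i; case: ifP.
  apply/seteqP; split => t /=.
    by move=> Yt i; case: eqP => // ->.
  by move=> /(_ j); rewrite eqxx.
- move=> _ _ [B mB ->] [C mC ->]; exists (fun j => B j `&` C j).
    by move=> j; exact: measurableI.
  apply/seteqP; split => t /=; first by move=> [H1 H2] j; split.
  by move=> H; split => j; have [] := H j.
- by rewrite bigcup_const.
- by move=> _ [B mB ->]; exact: m12.
- by move=> _ /=; rewrite probability_setT ltry.
Qed.

End gauss.

Section gaussian_vector.
Context {R : realType} {dim : nat} d1 (T1 : measurableType d1).
Variables (P1 : probability T1 R) (B : T1 -> dim.-tuple R).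
Hypothesis gB : std_gaussian_vector P1 B.
Local Open Scope ereal_scope.

Lemma measurable_gaussian_vector : measurable_fun setT B.
Proof. by case: gB. Qed.

Let mB := isMeasurableFun.Build _ _ _ _ B measurable_gaussian_vector.
Let BX : {mfun T1 >-> (dim.-tuple R)} := HB.pack B mB.

(** [std_gaussian_vector] prescribes the law on boxes, and boxes determine it; from here [B] may be
    traded for the canonical law. *)
Lemma gaussian_vector_law A : measurable A -> P1 (B @^-1` A) = gauss dim A.
Proof.
apply: (@tuple_measure_unique _ _ (distribution P1 BX) (gauss dim)) => C mC.
rewrite gauss_rect// -(gB.2 C mC); congr (P1 _).
by apply/seteqP; split => w /= H j; first (by move=> _; exact: H); exact: H.
Qed.

Lemma ge0_integral_gaussian_vector (f : dim.-tuple R -> \bar R) :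
  measurable_fun setT f -> (forall x, 0 <= f x) ->
  \int[P1]_w f (B w) = \int[gauss dim]_x f x.
Proof.
move=> mf f0; rewrite -[LHS](ge0_integral_distribution BX)//.
by apply: eq_measure_integral => // A mA _; exact: gaussian_vector_law.
Qed.

Lemma integral_gaussian_vector (f : dim.-tuple R -> \bar R) :
  measurable_fun setT f -> \int[P1]_w f (B w) = \int[gauss dim]_x f x.
Proof.
move=> mf; have := @signed_transfer _ _ _ _ _ _ _ P1 (gauss dim) B id (fun=> 1%R).
move=> /(_ (fun=> ler01)) -> //.
- by apply: eq_integral => x _; rewrite mule1.
- move=> g mg g0; rewrite ge0_integral_gaussian_vector//.
  by apply: eq_integral => x _; rewrite mule1.
Qed.

End gaussian_vector.

(** * Shifts and convolutions of the Gaussian law on tuples *)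

Section gauss_calculus.
Context {R : realType}.
Local Notation N01 := (@normal_prob R 0 1).
Local Open Scope ereal_scope.

Lemma integral_probability_cst dT (T : measurableType dT) (P : probability T R)
  (c : \bar R) : \int[P]_t c = c.
Proof. by rewrite integral_cst//= probability_setT mule1. Qed.

(** The density, with respect to [gauss d], of the Gaussian law translated by [s w]. *)
Definition cm_density d (s : R) (w y : d.-tuple R) : R :=
  expR (s * dot w y - s ^+ 2 * enorm w ^+ 2 / 2).

Lemma measurable_cm_density d (w : d.-tuple R) dT (T : measurableType dT)
    (s : T -> R) (f : T -> d.-tuple R) :
  measurable_fun setT s -> measurable_fun setT f ->
  measurable_fun setT (fun t => cm_density (s t) w (f t)).
Proof.
move=> ms mf; apply: measurableT_comp => //; apply: measurable_funB.
  by apply: measurable_funM => //; exact: measurable_dot.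
by do 2 (apply: measurable_funM => //); exact: measurable_funX.
Qed.

Lemma measurable_pairl dT dU dV (T : measurableType dT) (U : measurableType dU)
    (V : measurableType dV) (f : T * U -> V) x :
  measurable_fun setT f -> measurable_fun setT (fun u => f (x, u)).
Proof.
move=> mf; have -> : (fun u => f (x, u)) = f \o (fun u => (x, u)) by [].
by apply: measurableT_comp mf _; exact: measurable_fun_pair.
Qed.

(** The density factorizes over coordinates: the head is shifted by the one-dimensional formula, the
    tail by induction. *)
Lemma ge0_cameron_martin d (s : R) (w : d.-tuple R) (f : d.-tuple R -> \bar R) :
  measurable_fun setT f -> (forall x, 0 <= f x) ->
  \int[gauss d]_y f (tshift s y w) =
  \int[gauss d]_y (f y * (cm_density s w y)%:E).
Proof.
elim: d w f => [|d IH] w f mf f0.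
  have -> : \int[gauss 0]_y f (tshift s y w) = \int[gauss 0]_y f y.
    by apply: eq_integral => y _; rewrite (tuple0 (tshift s y w)) (tuple0 y).
  apply: eq_integral => y _.
  rewrite /cm_density sqr_enorm /dot !big_ord0 !mulr0 mul0r subr0 expR0.
  by rewrite mule1.
rewrite (tconsE w); set w0 := thead w; set w' := [tuple of behead w].
have ms : measurable_fun setT (fun y => tshift s y (tcons (w0, w'))).
  exact: measurable_tshift.
have mfc := measurable_comp_tcons mf.
rewrite ge0_gaussSE//; last exact: (measurableT_comp mf ms).
pose k (x : R) := \int[gauss d]_t (f (tcons (x, t)) * (cm_density s w' t)%:E).
have mk0 : measurable_fun setT (fun p : R * d.-tuple R =>
    f (tcons p) * (cm_density s w' p.2)%:E).
  apply: emeasurable_funM => //; apply/measurable_EFinP.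
  exact: (@measurable_cm_density _ w' _ _ (fun=> s) snd).
have k00 (p : R * d.-tuple R) : 0 <= f (tcons p) * (cm_density s w' p.2)%:E.
  by apply: mule_ge0 => //; rewrite lee_fin expR_ge0.
have mk : measurable_fun setT k.
  exact: (@measurable_fun_fubini_tonelli_F _ _ _ _ _ (gauss d)
    (fun p : R * d.-tuple R => f (tcons p) * (cm_density s w' p.2)%:E)).
have k0 x : 0 <= k x by apply: integral_ge0 => t _; exact: (k00 (x, t)).
transitivity (\int[N01]_x k (x + s * w0)%R).
  apply: eq_integral => x _.
  under eq_integral do rewrite tshift_tcons.
  rewrite (IH w' (fun t => f (tcons ((x + s * w0)%R, t))))//.
  exact: (measurable_pairl _ mfc).
rewrite ge0_cameron_martin1// ge0_gaussSE//; last 2 first.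
- apply: emeasurable_funM => //; apply/measurable_EFinP.
  exact: (@measurable_cm_density _ _ _ _ (fun=> s) id).
- by move=> t; apply: mule_ge0 => //; rewrite lee_fin expR_ge0.
apply: eq_integral => x _; rewrite /k -ge0_integralZr//; last exact: (measurable_pairl x mk0).
apply: eq_integral => t _; rewrite -muleA; congr (_ * _).
rewrite -EFinM; congr EFin; rewrite /cm_density -expRD; congr expR.
by rewrite dot_tcons enorm_tcons; field.
Qed.

Lemma cameron_martin d (s : R) (w : d.-tuple R) (f : d.-tuple R -> \bar R) :
  measurable_fun setT f ->
  \int[gauss d]_y f (tshift s y w) =
  \int[gauss d]_y (f y * (cm_density s w y)%:E).
Proof.
apply: (@signed_transfer _ _ _ _ _ _ _ (gauss d) (gauss d) (fun y => tshift s y w) id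
  (cm_density s w)).
- by move=> y; exact: expR_ge0.
- by move=> g mg g0; exact: ge0_cameron_martin.
Qed.

Lemma ge0_gauss_conv d (a b : R) (x : d.-tuple R) (f : d.-tuple R -> \bar R) :
  (0 < a)%R -> (0 < b)%R -> measurable_fun setT f -> (forall x, 0 <= f x) ->
  \int[gauss d]_y \int[gauss d]_z f (tshift b (tshift a x y) z) =
  \int[gauss d]_y f (tshift (Num.sqrt (a ^+ 2 + b ^+ 2)) x y).
Proof.
move=> a0 b0; set c := Num.sqrt _.
elim: d x f => [|d IH] x f mf f0.
  transitivity (\int[gauss 0]_(y in setT) f [tuple]).
    apply: eq_integral => y _.
    transitivity (\int[gauss 0]_(y in setT) f [tuple]).
      by apply: eq_integral => z _; rewrite (tuple0 (tshift _ _ _)).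
    exact: (integral_probability_cst (gauss 0)).
  by apply: eq_integral => z _; rewrite (tuple0 (tshift _ _ _)).
rewrite (tconsE x); set x0 := thead x; set x' := [tuple of behead x].
have mfc := measurable_comp_tcons mf.
have mab : measurable_fun setT (fun p : d.+1.-tuple R * d.+1.-tuple R =>
    f (tshift b (tshift a (tcons (x0, x')) p.1) p.2)).
  by apply: (measurableT_comp mf); apply: measurable_tshift => //;
    apply: measurable_tshift.
rewrite ge0_gaussSE//; last 2 first.
- exact: (@measurable_fun_fubini_tonelli_F _ _ _ _ _ (gauss d.+1)
    (fun p => f (tshift b (tshift a (tcons (x0, x')) p.1) p.2))).
- by move=> y; exact: integral_ge0.
pose F (y0 z0 : R) (y' z' : d.-tuple R) :=
  f (tcons ((x0 + a * y0 + b * z0)%R, tshift b (tshift a x' y') z')).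
pose k (r : R) := \int[gauss d]_u f (tcons ((x0 + r)%R, tshift c x' u)).
have mkp : measurable_fun setT (fun p : R * d.-tuple R =>
    f (tcons ((x0 + p.1)%R, tshift c x' p.2))).
  have -> : (fun p : R * d.-tuple R => f (tcons ((x0 + p.1)%R, tshift c x' p.2))) =
    (fun p => f (tcons p)) \o (fun p : R * d.-tuple R => ((x0 + p.1)%R, tshift c x' p.2)) by [].
  apply: measurableT_comp mfc _; apply: measurable_fun_pair.
    exact: measurable_funD.
  exact: measurable_tshift.
have mk : measurable_fun setT k.
  exact: (@measurable_fun_fubini_tonelli_F _ _ _ _ _ (gauss d)
    (fun p : R * d.-tuple R => f (tcons ((x0 + p.1)%R, tshift c x' p.2)))).
have k0 r : 0 <= k r by exact: integral_ge0.
transitivity (\int[N01]_y0 \int[N01]_z0 k (a * y0 + b * z0)%R); last first.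
  rewrite ge0_normal01_conv// ge0_gaussSE//; last first.
    by apply: (measurableT_comp mf); exact: measurable_tshift.
  apply: eq_integral => y0 _; apply: eq_integral => u _.
  by rewrite tshift_tcons.
apply: eq_integral => y0 _.
transitivity (\int[gauss d]_y' \int[N01]_z0 \int[gauss d]_z' F y0 z0 y' z').
  apply: eq_integral => y' _; rewrite ge0_gaussSE//; last first.
    exact: (measurable_pairl (tcons (y0, y')) mab).
  apply: eq_integral => z0 _; apply: eq_integral => z' _.
  by rewrite /F !tshift_tcons.
have mF : measurable_fun setT (fun p : (d.-tuple R * R) * d.-tuple R =>
    F y0 p.1.2 p.1.1 p.2).
  have -> : (fun p : (d.-tuple R * R) * d.-tuple R => F y0 p.1.2 p.1.1 p.2) =
    (fun p => f (tcons p)) \o (fun p : (d.-tuple R * R) * d.-tuple R =>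
      ((x0 + a * y0 + b * p.1.2)%R, tshift b (tshift a x' p.1.1) p.2)) by [].
  have m1 : measurable_fun setT (fun p : (d.-tuple R * R) * d.-tuple R => p.1.1).
    exact: (measurableT_comp measurable_fst).
  have m2 : measurable_fun setT (fun p : (d.-tuple R * R) * d.-tuple R => p.1.2).
    exact: (measurableT_comp measurable_snd).
  apply: measurableT_comp mfc _; apply: measurable_fun_pair.
    by apply: measurable_funD => //; exact: measurable_funM.
  by apply: measurable_tshift => //; exact: measurable_tshift.
(* Moving [z0] outside [y'] brings the two heads together and the two tails together, ready for the
   one-dimensional convolution and the induction hypothesis. *)
transitivity (\int[N01]_z0 \int[gauss d]_y' \int[gauss d]_z' F y0 z0 y' z').
  apply: (@fubini_tonelli _ _ _ _ _ (gauss d) N01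
    (fun p : d.-tuple R * R => \int[gauss d]_z' F y0 p.2 p.1 z')).
    apply: (@measurable_fun_fubini_tonelli_F _ _ _ _ _ (gauss d)
      (fun p : (d.-tuple R * R) * d.-tuple R => F y0 p.1.2 p.1.1 p.2)) => //.
    by move=> p; exact: f0.
  by move=> p; apply: integral_ge0 => z' _; exact: f0.
apply: eq_integral => z0 _.
rewrite (IH x' (fun t => f (tcons ((x0 + a * y0 + b * z0)%R, t))))//; last first.
  exact: (measurable_pairl _ mfc).
by apply: eq_integral => u _; rewrite addrA.
Qed.

End gauss_calculus.

(** * Standardized laws and Gaussian moments *)

Section integral_sums.
Context {R : realType} dT (T : measurableType dT) (P : probability T R).
Local Open Scope ereal_scope.

Lemma integral_add (f g : T -> R) (u v : R) :
  P.-integrable setT (EFin \o f) -> P.-integrable setT (EFin \o g) ->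
  \int[P]_t (f t)%:E = u%:E -> \int[P]_t (g t)%:E = v%:E ->
  \int[P]_t (f t + g t)%:E = (u + v)%:E.
Proof.
move=> fi gi fu gv; have := integral_lin2 0 1 1 fi gi fu gv.
rewrite add0r !mul1r => <-; apply: eq_integral => t _.
by rewrite add0r !mul1r.
Qed.

Lemma integral_scale (k : R) (f : T -> R) (u : R) :
  P.-integrable setT (EFin \o f) -> \int[P]_t (f t)%:E = u%:E ->
  \int[P]_t (k * f t)%:E = (k * u)%:E.
Proof.
move=> fi fu; have := integral_lin2 0 k 0 fi fi fu fu.
rewrite add0r mul0r addr0 => <-; apply: eq_integral => t _.
by rewrite add0r mul0r addr0.
Qed.

Lemma integral_bigsum (I : Type) (s : seq I) (f : I -> T -> R) (v : I -> R) :
  (forall i, P.-integrable setT (EFin \o f i)) ->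
  (forall i, \int[P]_t (f i t)%:E = (v i)%:E) ->
  \int[P]_t (\sum_(i <- s) f i t)%:E = (\sum_(i <- s) v i)%:E.
Proof.
move=> fi fv; elim: s => [|i s IH].
  by under eq_integral do rewrite big_nil; rewrite big_nil integral0.
under eq_integral do rewrite big_cons.
by rewrite big_cons; apply: integral_add => //; exact: integrable_bigsum.
Qed.

Lemma norm_integral_le (f g : T -> R) (u v : R) :
  P.-integrable setT (EFin \o f) -> P.-integrable setT (EFin \o g) ->
  (forall t, `|f t| <= g t)%R ->
  \int[P]_t (f t)%:E = u%:E -> \int[P]_t (g t)%:E = v%:E -> (`|u| <= v)%R.
Proof.
move=> fi gi fg fu gv; rewrite -lee_fin -gv -[(`|u|)%:E]/(`|u%:E|) -fu.
have mf := measurable_int _ fi.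
apply: (le_trans (le_abse_integral _ _ mf)) => //.
apply: ge0_le_integral => //.
- exact: measurableT_comp.
- exact: (measurable_int _ gi).
- by move=> t _; rewrite lee_fin.
Qed.

End integral_sums.

Section standardized.
Context {R : realType} {d : nat}.
Local Open Scope ereal_scope.

(** What the exchange asks of a step law: first and second moments matching the Gaussian ones, and a
    third moment for the remainder. Both the law of [xi 0] and [gauss] will satisfy it. *)
Definition standardized (nu : probability (d.-tuple R) R) : Prop :=
  [/\ nu.-integrable setT (EFin \o (fun y => enorm y ^+ 3)%R),
   forall j, \int[nu]_y (tnth y j)%:E = 0 &
   forall j k, \int[nu]_y (tnth y j * tnth y k)%:E = ((j == k)%:R)%:E].

Variable nu : probability (d.-tuple R) R.
Hypothesis snu : standardized nu.

Lemma standardized_integrable (f : d.-tuple R -> R) (C : R) :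
  measurable_fun setT f -> (forall y, `|f y| <= C * (1 + enorm y ^+ 3))%R ->
  nu.-integrable setT (EFin \o f).
Proof.
case: snu => i3 _ _ mf fC; apply: (integrable_le mf _ fC).
by apply: integrable_scale; apply: integrable_addr => //; exact: integrable_cst.
Qed.

Lemma le_1Dcube (r : R) : (0 <= r -> r <= 1 + r ^+ 3 /\ r ^+ 2 <= 1 + r ^+ 3)%R.
Proof. by move=> r0; split; have := sqr_ge0 (r - 1)%R; nra. Qed.

Lemma standardized_integrable_enorm : nu.-integrable setT (EFin \o @enorm R d).
Proof.
apply: (standardized_integrable (C := 1%R)); first exact: measurable_enorm.
move=> y; rewrite mul1r ger0_norm ?enorm_ge0//.
by have [] := le_1Dcube (enorm_ge0 y).
Qed.

Lemma standardized_integrable_tnth j :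
  nu.-integrable setT (EFin \o (fun y => tnth y j)).
Proof.
apply: (standardized_integrable (C := 1%R)); first exact: measurable_tnth.
move=> y; rewrite mul1r (le_trans (norm_tnth_le y j))//.
by have [] := le_1Dcube (enorm_ge0 y).
Qed.

Lemma standardized_integrable_tnth2 j k :
  nu.-integrable setT (EFin \o (fun y => tnth y j * tnth y k)%R).
Proof.
apply: (standardized_integrable (C := 1%R)).
  by apply: measurable_funM; exact: measurable_tnth.
move=> y; have [_] := le_1Dcube (enorm_ge0 y); rewrite mul1r; apply: le_trans.
by rewrite normrM expr2 ler_pM// norm_tnth_le.
Qed.

(** The value is the same for every standardized law; this is why the Taylor polynomial cancels when
    one step is replaced. *)
Lemma standardized_quad (c0 : R) (c : 'I_d -> R) (q : 'I_d -> 'I_d -> R) :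
  nu.-integrable setT (EFin \o (fun y =>
    c0 + \sum_j c j * tnth y j + \sum_j \sum_k q j k * (tnth y j * tnth y k))%R) /\
  \int[nu]_y (c0 + \sum_j c j * tnth y j +
    \sum_j \sum_k q j k * (tnth y j * tnth y k))%:E = (c0 + \sum_j q j j)%:E.
Proof.
have [i3 m0 cov] := snu.
have ij j := integrable_scale (c j) (standardized_integrable_tnth j).
have ijk j k := integrable_scale (q j k) (standardized_integrable_tnth2 j k).
have i1 := integrable_bigsum (index_enum 'I_d) ij.
have i2 := integrable_bigsum (index_enum 'I_d)
  (fun j => integrable_bigsum (index_enum 'I_d) (ijk j)).
have i01 := integrable_addr (integrable_cst nu c0) i1.
split; first exact: (integrable_addr i01 i2).
apply: integral_add => //.
- rewrite -[X in _ = X%:E]addr0; apply: integral_add => //.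
  + exact: integrable_cst.
  + by rewrite integral_probability_cst.
  + rewrite (@integral_bigsum _ _ _ _ _ _ _ (fun j => c j * 0)%R)//.
      by rewrite big1// => j _; rewrite mulr0.
    by move=> j; apply: integral_scale => //; exact: standardized_integrable_tnth.
- rewrite (@integral_bigsum _ _ _ _ _ _ _ (fun j => \sum_k q j k * (j == k)%:R)%R).
  + congr EFin; apply: eq_bigr => j _; rewrite (bigD1 j)//= eqxx mulr1 big1 ?addr0//.
    by move=> k kj; rewrite eq_sym (negbTE kj) mulr0.
  + by move=> j; exact: (integrable_bigsum _ (ijk j)).
  + move=> j; apply: integral_bigsum => k; first exact: ijk.
    by apply: integral_scale => //; exact: standardized_integrable_tnth2.
Qed.

Lemma standardized_dot2 (w : d.-tuple R) :
  nu.-integrable setT (EFin \o (fun y => dot w y ^+ 2)%R) /\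
  \int[nu]_y (dot w y ^+ 2)%:E = (enorm w ^+ 2)%:E.
Proof.
have := standardized_quad 0%R (fun=> 0%R) (fun j k => tnth w j * tnth w k)%R.
have E y : (0 + \sum_j 0 * tnth y j +
    \sum_j \sum_k tnth w j * tnth w k * (tnth y j * tnth y k) = dot w y ^+ 2)%R.
  by rewrite sqr_dot big1 ?addr0 ?add0r// => j _; rewrite mul0r.
have -> : (fun y => (0 + \sum_j 0 * tnth y j +
    \sum_j \sum_k tnth w j * tnth w k * (tnth y j * tnth y k))%R) =
    (fun y => dot w y ^+ 2)%R by apply/funext.
under eq_integral do rewrite E.
by rewrite add0r sqr_enorm.
Qed.

End standardized.

(** * Moments of the Gaussian law on tuples *)

Section gauss_moments.
Context {R : realType}.
Local Notation N01 := (@normal_prob R 0 1).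
Local Open Scope ereal_scope.

Lemma gauss_enorm2 d : \int[gauss d]_y (enorm y ^+ 2)%:E = (d%:R : R)%:E.
Proof.
elim: d => [|d IH].
  rewrite gauss0E; first by rewrite sqr_enorm big_ord0.
  by apply/measurable_EFinP/measurable_funX; exact: measurable_enorm.
rewrite ge0_gaussSE; last 2 first.
- by apply/measurable_EFinP/measurable_funX; exact: measurable_enorm.
- by move=> t; rewrite lee_fin sqr_ge0.
have i2 : (@gauss R d).-integrable setT (EFin \o (fun y => enorm y ^+ 2)%R).
  apply: (@ge0_integrable _ _ _ (@gauss R d) _ d%:R).
  - by apply: measurable_funX; exact: measurable_enorm.
  - by move=> t; exact: sqr_ge0.
  - by rewrite IH.
have iX := @normal01_integrableX R 2.
transitivity (\int[N01]_x (d%:R + 1 * x ^+ 2 + 0 * x ^+ 2)%:E).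
  apply: eq_integral => x _.
  have := integral_lin2 (x ^+ 2) 1 0 i2 i2 IH IH.
  rewrite !mul1r !mul0r !addr0 addrC => <-.
  by apply: eq_integral => t _; rewrite enorm_tcons mul1r mul0r addr0.
have mom := @normal01_second_moment R.
rewrite (@integral_lin2 _ _ _ N01 _ _ _ _ _ _ _ iX iX mom mom).
by rewrite mul0r addr0 mul1r -natr1.
Qed.

(** Splitting off one coordinate expands [(x^2 + |t|^2)^2], and
    [3 + 2 d + d (d + 2) = (d + 1) (d + 3)]. *)
Lemma gauss_enorm4 d :
  \int[gauss d]_y (enorm y ^+ 4)%:E = (d%:R * (d%:R + 2) : R)%:E.
Proof.
have m4 n : measurable_fun setT (fun y : n.-tuple R => enorm y ^+ 4)%R.
  by apply: measurable_funX; exact: measurable_enorm.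
have p4 n (y : n.-tuple R) : (0 <= enorm y ^+ 4)%R by rewrite exprn_ge0// enorm_ge0.
elim: d => [|d IH].
  rewrite gauss0E; last by apply/measurable_EFinP; exact: m4.
  have /eqP : (enorm ([tuple] : 0.-tuple R) ^+ 2 = 0)%R by rewrite sqr_enorm big_ord0.
  by rewrite sqrf_eq0 => /eqP ->; rewrite expr0n mul0r.
rewrite ge0_gaussSE; last 2 first.
- by apply/measurable_EFinP; exact: m4.
- by move=> t; rewrite lee_fin.
have i4 : (@gauss R d).-integrable setT (EFin \o (fun y => enorm y ^+ 4)%R).
  apply: (@ge0_integrable _ _ _ (@gauss R d) _ (d%:R * (d%:R + 2))%R).
  - exact: m4.
  - exact: p4.
  - by rewrite IH.
have i2 : (@gauss R d).-integrable setT (EFin \o (fun y => enorm y ^+ 2)%R).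
  apply: (@ge0_integrable _ _ _ (@gauss R d) _ d%:R).
  - by apply: measurable_funX; exact: measurable_enorm.
  - by move=> t; exact: sqr_ge0.
  - by rewrite gauss_enorm2.
have iX2 := @normal01_integrableX R 2; have iX4 := @normal01_integrableX R 4.
transitivity (\int[N01]_x (d%:R * (d%:R + 2) + 1 * x ^+ 4 + (2 * d%:R) * x ^+ 2)%:E).
  apply: eq_integral => x _.
  have := integral_lin2 (x ^+ 4) (2 * x ^+ 2) 1 i2 i4 (gauss_enorm2 d) IH.
  rewrite (_ : (x ^+ 4 + 2 * x ^+ 2 * d%:R + 1 * (d%:R * (d%:R + 2)) =
    d%:R * (d%:R + 2) + 1 * x ^+ 4 + 2 * d%:R * x ^+ 2)%R); last by ring.
  move=> <-; apply: eq_integral => t _; congr EFin.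
  have -> : (enorm (tcons (x, t)) ^+ 4 = (enorm (tcons (x, t)) ^+ 2) ^+ 2)%R by rewrite -exprM.
  by rewrite enorm_tcons; ring.
rewrite (@integral_lin2 _ _ _ N01 _ _ _ _ _ _ _ iX4 iX2
  normal01_fourth_moment normal01_second_moment).
by congr EFin; rewrite -natr1; ring.
Qed.

Lemma gauss_integrable_enorm4 d :
  (gauss d).-integrable setT (EFin \o (fun y : d.-tuple R => enorm y ^+ 4)%R).
Proof.
apply: (@ge0_integrable _ _ _ (@gauss R d) _ (d%:R * (d%:R + 2))%R).
- by apply: measurable_funX; exact: measurable_enorm.
- by move=> y; rewrite exprn_ge0// enorm_ge0.
- by rewrite gauss_enorm4.
Qed.

Lemma gauss_integrable d (f : d.-tuple R -> R) (C : R) : measurable_fun setT f ->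
  (forall y, `|f y| <= C * (1 + enorm y ^+ 4))%R ->
  (gauss d).-integrable setT (EFin \o f).
Proof.
move=> mf fC; apply: (integrable_le mf _ fC).
apply: integrable_scale; apply: integrable_addr; first exact: integrable_cst.
exact: gauss_integrable_enorm4.
Qed.

Lemma le_1Dpow4 (r : R) :
  (0 <= r -> [/\ r <= 1 + r ^+ 4, r ^+ 2 <= 1 + r ^+ 4 & r ^+ 3 <= 1 + r ^+ 4])%R.
Proof.
move=> r0; have h2 : (r ^+ 2 <= 1 + r ^+ 4)%R.
  by rewrite (_ : 4 = 2 * 2)%N// exprM; have := sqr_ge0 (r ^+ 2 - 1)%R; nra.
have [r1|/ltW r1] := leP r 1%R.
  have r4 : (0 <= r ^+ 4)%R by exact: exprn_ge0.
  split=> //; first by rewrite (le_trans r1)// lerDl.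
  by rewrite (@le_trans _ _ 1%R)// ?lerDl// exprn_ile1.
have h34 : (r ^+ 3 <= 1 + r ^+ 4)%R.
  by rewrite (@le_trans _ _ (r ^+ 4))%R// ?ler_weXn2l// lerDr.
by split=> //; apply: le_trans h2; exact: ler_eXnr.
Qed.

Lemma gauss_standardized d : standardized (@gauss R d).
Proof.
have i1 n (j : 'I_n) : (@gauss R n).-integrable setT (EFin \o (fun y => tnth y j)).
  apply: (gauss_integrable (C := 1%R)); first exact: measurable_tnth.
  move=> y; rewrite mul1r (le_trans (norm_tnth_le y j))//.
  by have [] := le_1Dpow4 (enorm_ge0 y).
have i2 n (j k : 'I_n) :
    (@gauss R n).-integrable setT (EFin \o (fun y => tnth y j * tnth y k)%R).
  apply: (gauss_integrable (C := 1%R)).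
    by apply: measurable_funM; exact: measurable_tnth.
  move=> y; have [_ + _] := le_1Dpow4 (enorm_ge0 y); rewrite mul1r; apply: le_trans.
  by rewrite normrM expr2 ler_pM// norm_tnth_le.
have mean n (j : 'I_n) : \int[gauss n]_y (tnth y j)%:E = 0 :> \bar R.
  elim: n j => [[]//|n IH] j; rewrite gaussSE//; last exact: i1.
  have [k ->|->] := unliftP ord0 j.
    transitivity (\int[N01]_(x in setT) (0 : \bar R)); last exact: integral0.
    apply: eq_integral => x _; rewrite -(IH k); apply: eq_integral => t _.
    by rewrite tnth_tconsS.
  rewrite -(@normal01_mean R); apply: eq_integral => x _.
  by rewrite -[RHS](integral_probability_cst (gauss n)).
split.
- apply: (gauss_integrable (C := 1%R)).
    by apply: measurable_funX; exact: measurable_enorm.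
  move=> y; rewrite mul1r ger0_norm ?exprn_ge0 ?enorm_ge0//.
  by have [] := le_1Dpow4 (enorm_ge0 y).
- exact: mean.
elim: d => [[]//|d IH] j k; rewrite gaussSE//; last exact: i2.
have [j' ->|->] := unliftP ord0 j; have [k' ->|->] := unliftP ord0 k.
- rewrite (inj_eq (@lift_inj _ ord0)) -IH -[RHS](integral_probability_cst N01).
  apply: eq_integral => x _; apply: eq_integral => t _.
  by rewrite !tnth_tconsS.
- transitivity (\int[N01]_(x in setT) (0 : \bar R)); last first.
    by rewrite integral0.
  apply: eq_integral => x _.
  have := integral_scale x (i1 _ j') (mean _ j'); rewrite mulr0 => E.
  by apply: etrans E; apply: eq_integral => t _; rewrite tnth_tconsS tnth_tcons0 mulrC.
- transitivity (\int[N01]_(x in setT) (0 : \bar R)); last first.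
    by rewrite integral0.
  apply: eq_integral => x _.
  have := integral_scale x (i1 _ k') (mean _ k'); rewrite mulr0 => E.
  by apply: etrans E; apply: eq_integral => t _; rewrite tnth_tconsS tnth_tcons0.
- rewrite eqxx -(@normal01_second_moment R); apply: eq_integral => x _.
  by rewrite -[RHS](integral_probability_cst (gauss d)).
Qed.

(* Integrate [r^3 + rho r^2 <= rho^2 r + r^4 / rho] at [rho = sqrt (d + 2)], where
   the second and fourth moments [d] and [d (d + 2)] cancel. *)
Lemma gauss_enorm3_le d :
  \int[gauss d]_y (enorm y ^+ 3)%:E <=
  (d%:R + 2)%:E * \int[@gauss R d]_y (enorm y)%:E.
Proof.
pose rho : R := Num.sqrt (d%:R + 2).
have d2 : (0 < d%:R + 2 :> R)%R by rewrite addrC ltr_wpDr.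
have rho0 : (0 < rho)%R by rewrite sqrtr_gt0.
have rho2 : (rho ^+ 2 = d%:R + 2)%R by rewrite sqr_sqrtr// ltW.
have sg := gauss_standardized d.
have [i3 _ _] := sg; have i1 := standardized_integrable_enorm sg.
have i4 := gauss_integrable_enorm4 d.
have i2 : (@gauss R d).-integrable setT (EFin \o (fun y => enorm y ^+ 2)%R).
  apply: (gauss_integrable (C := 1%R)).
    by apply: measurable_funX; exact: measurable_enorm.
  move=> y; rewrite mul1r ger0_norm ?exprn_ge0 ?enorm_ge0//.
  by have [] := le_1Dpow4 (enorm_ge0 y).
have f1 := integrable_fin_num measurableT i1.
have f3 := integrable_fin_num measurableT i3.
rewrite /= in f1 f3.
rewrite -(fineK f1) -(fineK f3) -EFinM lee_fin.
set u := fine _; set v := fine _.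
have e1 := integral_lin2 0 1 rho i3 i2 (esym (fineK f3)) (gauss_enorm2 d).
have e2 := integral_lin2 0 (rho ^+ 2) rho^-1 i1 i4 (esym (fineK f1)) (gauss_enorm4 d).
suff : (0 + 1 * u + rho * d%:R <= 0 + rho ^+ 2 * v + rho^-1 * (d%:R * (d%:R + 2)))%R.
  rewrite -rho2 (_ : rho^-1 * (d%:R * rho ^+ 2) = rho * d%:R)%R.
    by rewrite !add0r mul1r lerD2r.
  by field; rewrite gt_eqF.
rewrite -lee_fin -e1 -e2; apply: ge0_le_integral => //.
- move=> y _; have y0 := enorm_ge0 y.
  by rewrite lee_fin add0r mul1r addr_ge0 ?exprn_ge0// mulr_ge0 ?sqr_ge0// ltW.
- apply/measurable_EFinP; apply: measurable_funD; [apply: measurable_funD => //|];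
    by apply: measurable_funM => //; apply: measurable_funX; exact: measurable_enorm.
- apply/measurable_EFinP; apply: measurable_funD; [apply: measurable_funD => //|];
    apply: measurable_funM => //; last apply: measurable_funX; exact: measurable_enorm.
- move=> y _; rewrite lee_fin !add0r mul1r -subr_ge0.
  have y0 := enorm_ge0 y; set r := enorm y in y0 *.
  rewrite (_ : _ - _ = r * (r - rho) ^+ 2 * (r + rho) / rho)%R; last first.
    by field; rewrite gt_eqF.
  have r2 := ltW rho0.
  by rewrite divr_ge0// mulr_ge0 ?addr_ge0// mulr_ge0// sqr_ge0.
Qed.

End gauss_moments.

(** * Gaussian smoothing *)

Section smoothing.
Context {R : realType} {d : nat}.
Local Open Scope ereal_scope.
Implicit Types (h : d.-tuple R -> R) (x y z v : d.-tuple R).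

(** Real-valued so that [avg] can be iterated; [fine] sends an infinite integral to 0, and [avgE]
    certifies that this does not occur for a standardized law and a Lipschitz [h]. *)
Definition avg (nu : probability (d.-tuple R) R) (a : R) h z : R :=
  fine (\int[nu]_y (h (tshift a z y))%:E).

Lemma measurable_lip1_tshift h (a : R) z : lip1 h ->
  measurable_fun setT (fun y => h (tshift a z y)).
Proof.
move=> hl; apply: (measurableT_comp (lip1_measurable hl)).
exact: measurable_tshift.
Qed.

Lemma lip1_integrable (nu : probability (d.-tuple R) R) h (a : R) z :
  standardized nu -> lip1 h ->
  nu.-integrable setT (EFin \o (fun y => h (tshift a z y))).
Proof.
move=> snu hl; apply: (@integrable_le _ _ _ nu _ (fun y => `|h z| + `|a| * enorm y)%R).
- exact: measurable_lip1_tshift.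
- apply: integrable_addr; first exact: integrable_cst.
  by apply: integrable_scale; exact: standardized_integrable_enorm.
- by move=> y; exact: lip1_growth.
Qed.

Lemma avgE (nu : probability (d.-tuple R) R) h (a : R) z :
  standardized nu -> lip1 h -> \int[nu]_y (h (tshift a z y))%:E = (avg nu a h z)%:E.
Proof.
move=> snu hl; rewrite fineK//; apply: integrable_fin_num => //.
exact: (lip1_integrable _ _ snu hl).
Qed.

(** Both points receive the same step, which preserves their distance; hence every intermediate
    function of the exchange stays 1-Lipschitz. *)
Lemma avg_lip1 (nu : probability (d.-tuple R) R) h (a : R) :
  standardized nu -> lip1 h -> lip1 (avg nu a h).
Proof.
move=> snu hl z z'.
have i1 := lip1_integrable a z snu hl; have i2 := lip1_integrable a z' snu hl.
have i2' := integrable_scale (-1) i2.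
have i12 := integrable_addr i1 i2'.
have e2 := integral_scale (-1) i2 (avgE a z' snu hl).
have e := integral_add i1 i2' (avgE a z snu hl) e2.
rewrite mulN1r in e.
apply: (norm_integral_le i12 (integrable_cst _ (edist z z')) _ e).
- by move=> y; rewrite mulN1r -(edist_tshiftl a z z' y); exact: hl.
- by rewrite integral_probability_cst.
Qed.

Lemma gauss_integrable_lip1M h (a : R) z (f : d.-tuple R -> R) : lip1 h ->
  measurable_fun setT f -> (forall y, `|f y| <= 1 + enorm y ^+ 2)%R ->
  (gauss d).-integrable setT (EFin \o (fun y => h (tshift a z y) * f y)%R).
Proof.
move=> hl mf f2; apply: (gauss_integrable (C := ((`|h z| + `|a|) * 2)%R)).
  by apply: measurable_funM => //; exact: measurable_lip1_tshift.
move=> y; rewrite normrM.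
have r0 := enorm_ge0 y; have [r1 r2 r3] := le_1Dpow4 r0.
set r := enorm y in r0 r1 r2 r3 *.
rewrite (le_trans (ler_pM _ _ (lip1_growth a z y hl) (f2 y)))// -/r.
have r4 : (0 <= r ^+ 4)%R by exact: exprn_ge0.
have -> : ((`|h z| + `|a| * r) * (1 + r ^+ 2) =
  `|h z| * (1 + r ^+ 2) + `|a| * (r + r ^+ 3))%R by ring.
have -> : ((`|h z| + `|a|) * 2 * (1 + r ^+ 4) =
  `|h z| * (2 * (1 + r ^+ 4)) + `|a| * (2 * (1 + r ^+ 4)))%R by ring.
by apply: lerD; apply: ler_wpM2l => //; lra.
Qed.

End smoothing.

(** * Second-order expansion of Gaussian averages *)

Section taylor.
Context {R : realType} {d : nat}.
Local Notation mu := (@lebesgue_measure R).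
Local Open Scope ereal_scope.
Variables (h : d.-tuple R -> R) (a b : R) (x v : d.-tuple R).
Hypotheses (hl : lip1 h) (a0 : (0 < a)%R) (b0 : (0 < b)%R).

(** Measured in units of the smoothing scale [a], the step [b v] becomes [rho v], that is
    [h (x + b v + a y) = H (y + rho v)]. Under [gauss d], [N] is centred Gaussian with variance
    [sigma], and [K2] is its second Hermite polynomial. *)
Let H y := h (tshift a x y).
Let rho := (b / a)%R.
Let sigma := (rho ^+ 2 * enorm v ^+ 2)%R.
Let N y := (rho * dot v y)%R.
Let K2 y := (N y ^+ 2 - sigma)%R.

Let rho0 : (0 < rho)%R. Proof. exact: divr_gt0. Qed.
Let sigma0 : (0 <= sigma)%R. Proof. by rewrite mulr_ge0// sqr_ge0. Qed.
Let arho : (a * rho = b)%R. Proof. by rewrite mulrC divfK// gt_eqF. Qed.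

Let mH : measurable_fun setT H. Proof. exact: measurable_lip1_tshift. Qed.
Let mN : measurable_fun setT N.
Proof. by apply: measurable_funM => //; exact: measurable_dot. Qed.
Let mK2 : measurable_fun setT K2.
Proof. by apply: measurable_funB => //; exact: measurable_funX. Qed.

Let H_shift s y : (`|H (tshift s y v) - H y| <= a * `|s| * enorm v)%R.
Proof.
by rewrite /H tshiftA (le_trans (lip1_tshift_le _ _ _ hl))// normrM gtr0_norm.
Qed.

Let L := (\sum_(j < d) `|tnth v j|)%R.
(** A domination constant for integrability only; the final estimate does not contain it. *)
Let C0 := ((`|h x| + b * enorm v + a) * (rho ^+ 2 * L ^+ 2 + sigma))%R.

Let K2_le y : (`|K2 y| <= rho ^+ 2 * L ^+ 2 * enorm y ^+ 2 + sigma)%R.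
Proof.
rewrite (le_trans (ler_normB _ _))// (ger0_norm sigma0) lerD2r.
rewrite ger0_norm ?sqr_ge0// /N exprMn -mulrA ler_pM2l ?exprn_gt0// -exprMn.
rewrite -[leLHS]real_normK ?num_real// ler_pXn2r ?nnegrE ?mulr_ge0 ?enorm_ge0//.
  exact: norm_dot_le.
by apply: sumr_ge0.
Qed.

Let HK2_le s y : (0 <= s <= 1)%R ->
  (`|H (tshift (s * rho) y v) * K2 y| <= C0 * (1 + enorm y ^+ 4))%R.
Proof.
move=> /andP[s0 s1].
have r0 := enorm_ge0 y; set r := enorm y in r0 *.
have v0 := enorm_ge0 v.
have h1 : (`|H (tshift (s * rho) y v)| <= `|h x| + b * enorm v + a * r)%R.
  rewrite -[H _](subrK (H y)) (le_trans (ler_normD _ _))// addrC.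
  have hx : (`|H y| <= `|h x| + a * r)%R.
    by have := lip1_growth a x y hl; rewrite (gtr0_norm a0).
  have hs : (`|H (tshift (s * rho) y v) - H y| <= b * enorm v)%R.
    rewrite (le_trans (H_shift _ _))// ler_wpM2r// ger0_norm; last first.
      by rewrite mulr_ge0// ltW.
    by rewrite mulrCA arho ler_piMl// ltW.
  lra.
have [r1 r2 r3] := le_1Dpow4 r0.
rewrite normrM (le_trans (ler_pM _ _ h1 (K2_le y)))// -/r /C0.
set A := (`|h x| + b * enorm v)%R; set B := (rho ^+ 2 * L ^+ 2)%R.
have A0 : (0 <= A)%R by rewrite addr_ge0// mulr_ge0// ltW.
have B0 : (0 <= B)%R by rewrite mulr_ge0// sqr_ge0.
have aa := ltW a0.
have -> : ((A + a * r) * (B * r ^+ 2 + sigma) =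
  A * B * r ^+ 2 + A * sigma + a * B * r ^+ 3 + a * sigma * r)%R by ring.
have -> : ((A + a) * (B + sigma) * (1 + r ^+ 4) =
  A * B * (1 + r ^+ 4) + A * sigma * (1 + r ^+ 4) +
  a * B * (1 + r ^+ 4) + a * sigma * (1 + r ^+ 4))%R by ring.
have r4 : (1 <= 1 + r ^+ 4)%R by rewrite lerDl exprn_ge0.
have sg := sigma0.
have [AB As] := (mulr_ge0 A0 B0, mulr_ge0 A0 sg).
have [aB as_] := (mulr_ge0 aa B0, mulr_ge0 aa sg).
by rewrite !lerD// ?ler_wpM2l// ler_peMr.
Qed.

(** The second derivative in [s] of the shift density [exp (s N - s^2 sigma / 2)]; at [s = 0] it
    equals [K2]. *)
Let e2 s y := (((N y - s * sigma) ^+ 2 - sigma) * cm_density (s * rho) v y)%R.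

Let me2 : measurable_fun setT (fun p : R * d.-tuple R => e2 p.1 p.2).
Proof.
have mN2 : measurable_fun setT (fun p : R * d.-tuple R => N p.2).
  exact: (measurableT_comp mN).
apply: measurable_funM; last first.
  by apply: measurable_cm_density => //; exact: measurable_funM.
apply: measurable_funB => //; apply: measurable_funX.
by apply: measurable_funB => //; exact: measurable_funM.
Qed.

Let N_shift s y : (N (tshift (s * rho) y v) - s * sigma = N y)%R.
Proof. by rewrite /N dot_tshift /sigma; ring. Qed.

(** Shifting by [s rho v] turns [N - s sigma] into [N] and absorbs the density, so that [s] survives
    only in the argument of [G]. *)
Let cm_e2 s (G : d.-tuple R -> R) : measurable_fun setT G ->
  \int[gauss d]_y (G y * e2 s y)%:E =
  \int[gauss d]_y (G (tshift (s * rho) y v) * K2 y)%:E.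
Proof.
move=> mG.
pose F y := (G y * ((N y - s * sigma) ^+ 2 - sigma))%R.
transitivity (\int[gauss d]_y ((F y)%:E * (cm_density (s * rho) v y)%:E)).
  by apply: eq_integral => y _; rewrite -EFinM /F /e2 mulrA.
rewrite -cameron_martin; last first.
  apply/measurable_EFinP; apply: measurable_funM => //.
  apply: measurable_funB => //; apply: measurable_funX.
  exact: measurable_funB.
by apply: eq_integral => y _; rewrite /F N_shift.
Qed.

Let iHK2 s : (0 <= s <= 1)%R ->
  (gauss d).-integrable setT (EFin \o (fun y => H (tshift (s * rho) y v) * K2 y)%R).
Proof.
move=> s01; apply: (gauss_integrable (C := C0)); last by move=> y; exact: HK2_le.
apply: measurable_funM => //; apply: (measurableT_comp mH).
exact: measurable_tshift.
Qed.

Let tshift0 y : tshift (0 * rho) y v = y.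
Proof.
by apply: eq_from_tnth => j; rewrite tnth_tshift !mul0r addr0.
Qed.

Let iHK : (gauss d).-integrable setT (EFin \o (fun y => H y * K2 y)%R).
Proof.
have := @iHK2 0%R; rewrite lexx ler01 => /(_ isT).
by apply: eq_integrable => // y _ /=; rewrite tshift0.
Qed.

Let M0 := (C0 * (1 + d%:R * (d%:R + 2)))%R.

Let int_bound : \int[gauss d]_y (C0 * (1 + enorm y ^+ 4))%:E = M0%:E.
Proof.
apply: integral_scale.
  apply: integrable_addr; first exact: integrable_cst.
  exact: gauss_integrable_enorm4.
apply: integral_add; [exact: integrable_cst|exact: gauss_integrable_enorm4| |].
  by rewrite integral_probability_cst.
exact: gauss_enorm4.
Qed.

Let HK2_int_le s : (0 <= s <= 1)%R ->
  \int[gauss d]_y `|H (tshift (s * rho) y v) * K2 y|%:E <= M0%:E.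
Proof.
move=> s01; rewrite -int_bound; apply: ge0_le_integral => //.
- by move/integrableP: (iHK2 s01) => [+ _]; move/measurable_EFinP => m;
    apply/measurable_EFinP; exact: measurableT_comp.
- apply/measurable_EFinP; apply: measurable_funM => //; apply: measurable_funD => //.
  by apply: measurable_funX; exact: measurable_enorm.
- by move=> y _; rewrite lee_fin HK2_le.
Qed.

Let iHe2 s : (0 <= s <= 1)%R ->
  \int[gauss d]_y `|H y * e2 s y|%:E <= M0%:E.
Proof.
move=> s01; apply: le_trans (HK2_int_le s01); rewrite le_eqVlt; apply/orP; left.
apply/eqP.
pose F y := (`|H y| * `|(N y - s * sigma) ^+ 2 - sigma|)%R.
transitivity (\int[gauss d]_y ((F y)%:E * (cm_density (s * rho) v y)%:E)).
  apply: eq_integral => y _; rewrite -EFinM /F /e2 !normrM mulrA.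
  by rewrite (ger0_norm (expR_ge0 _)).
rewrite -cameron_martin; last first.
  apply/measurable_EFinP; apply: measurable_funM; apply: measurableT_comp => //.
  apply: measurable_funB => //; apply: measurable_funX.
  exact: measurable_funB.
by apply: eq_integral => y _; rewrite /F N_shift normrM.
Qed.

Let me2s s : measurable_fun setT (e2 s).
Proof. exact: (measurable_pairl s me2). Qed.

(** Integral form of the Taylor remainder [g]: the second-order term is subtracted under the
    integral as [(1 - s) K2], instead of being integrated separately, so that [cm_e2] will produce
    an increment of [H]. *)
Let g' s y := ((1 - s) * (H y * e2 s y + -1 * (H y * K2 y)))%R.
Let T2 y := (1 + N y + K2 y / 2)%R.
Let g y := (H y * cm_density rho v y + -1 * (H y * T2 y))%R.

Let mg' : measurable_fun setT (fun p : R * d.-tuple R => g' p.1 p.2).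
Proof.
have mH2 : measurable_fun setT (fun p : R * d.-tuple R => H p.2).
  exact: (measurableT_comp mH).
have mK22 : measurable_fun setT (fun p : R * d.-tuple R => K2 p.2).
  exact: (measurableT_comp mK2).
apply: measurable_funM; first exact: measurable_funB.
apply: measurable_funD; first exact: measurable_funM.
by apply: measurable_funM => //; exact: measurable_funM.
Qed.

Let ie s : (0 <= s <= 1)%R -> (gauss d).-integrable setT (EFin \o (fun y => H y * e2 s y)%R).
Proof.
move=> s01; apply/integrableP; split.
  by apply/measurable_EFinP; exact: measurable_funM.
by rewrite (le_lt_trans (iHe2 s01))// ltry.
Qed.

Let FTC y : \int[mu]_(s in `[0%R, 1%R]) (g' s y)%:E = (g y)%:E.
Proof.
pose n := N y.
pose q : {poly R} := (n *: 'X - (sigma / 2) *: 'X^2)%R.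
(* Integration by parts: with [E = exp q], a primitive of [(1 - s) E''] is [(1 - s) E' + E]. The
   polynomial [r] below is a primitive of the subtracted term. *)
pose p : {poly R} := (H y *: ((1 - 'X) * (n%:P - sigma *: 'X) + 1))%R.
pose r : {poly R} := ((H y * (n ^+ 2 - sigma) / 2) *: (1 - 'X) ^+ 2)%R.
have evq s : q.[s] = (s * n - s ^+ 2 * sigma / 2)%R.
  by rewrite !(hornerD, hornerN, hornerZ, hornerX, hornerXn); ring.
have evp s : p.[s] = (H y * ((1 - s) * (n - s * sigma) + 1))%R.
  by rewrite !(hornerD, hornerN, hornerZ, hornerX, hornerXn, hornerM, hornerC); ring.
have evr s : r.[s] = (H y * (n ^+ 2 - sigma) / 2 * (1 - s) ^+ 2)%R.
  by rewrite !(hornerZ, horner_exp, hornerD, hornerN, hornerX, hornerC).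
have evq' s : (q^`().[s] = n - s * sigma)%R.
  rewrite derivD derivN !derivZ derivX derivXn.
  rewrite !(hornerD, hornerN, hornerZ, hornerC, hornerMn, hornerXn) /= expr1.
  by field.
have evp' s : (p^`().[s] = H y * (- (n - s * sigma) - sigma * (1 - s)))%R.
  rewrite derivZ derivD derivM !derivD !derivN !derivZ !derivX !derivC.
  by rewrite !(hornerD, hornerN, hornerZ, hornerX, hornerM, hornerC); ring.
have evr' s : (r^`().[s] = - (H y * (n ^+ 2 - sigma) * (1 - s)))%R.
  rewrite derivZ expr2 derivM derivD derivN derivX derivC.
  by rewrite !(hornerD, hornerN, hornerZ, hornerX, hornerM, hornerC); field.
have cmE s : cm_density (s * rho) v y = expR q.[s].
  by rewrite evq /cm_density /n /N /sigma; congr expR; ring.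
have := exppoly_FTC p q r; rewrite -!cmE !evp !evr => E.
rewrite (_ : g y = (H y * ((1 - 1) * (n - 1 * sigma) + 1) * cm_density (1 * rho) v y +
         H y * (n ^+ 2 - sigma) / 2 * (1 - 1) ^+ 2 -
         (H y * ((1 - 0) * (n - 0 * sigma) + 1) * cm_density (0 * rho) v y +
          H y * (n ^+ 2 - sigma) / 2 * (1 - 0) ^+ 2))%R); last first.
  rewrite (_ : cm_density (0 * rho) v y = 1%R); last first.
    by rewrite cmE evq (_ : (0 * n - 0 ^+ 2 * sigma / 2 = 0)%R) ?expR0//; ring.
  by rewrite [(1 * rho)%R]mul1r /g /T2 /K2 -/n; field.
rewrite -E; apply: eq_integral => s _; congr EFin.
rewrite -cmE hornerD hornerM evp' evp evq' evr' /g' /e2 /K2 -/n.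
by ring.
Qed.

Let g'M s : (0 <= s <= 1)%R -> \int[gauss d]_y `|g' s y|%:E <= (M0 + M0)%:E.
Proof.
move=> s01; have /andP[s0 s1] := s01.
have m1 : measurable_fun setT (fun y => `|H y * e2 s y|)%R.
  by apply: measurableT_comp => //; exact: measurable_funM.
have m2 : measurable_fun setT (fun y => `|H y * K2 y|)%R.
  by apply: measurableT_comp => //; exact: measurable_funM.
apply: (@le_trans _ _ (\int[gauss d]_y ((`|H y * e2 s y|)%:E + (`|H y * K2 y|)%:E))).
  apply: ge0_le_integral => //.
  - apply/measurable_EFinP; apply: measurableT_comp => //.
    exact: (measurable_pairl s mg').
  - by apply: emeasurable_funD; exact/measurable_EFinP.
  - move=> y _; rewrite -EFinD lee_fin /g' mulN1r [leLHS]normrM.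
    apply: le_trans (ler_normB _ _); rewrite ler_piMl//.
    by rewrite ger0_norm ?subr_ge0// gerBl.
rewrite ge0_integralD//; last 2 first.
- exact/measurable_EFinP.
- exact/measurable_EFinP.
rewrite EFinD; apply: leeD; first exact: iHe2.
have := @HK2_int_le 0%R; rewrite lexx ler01 => /(_ isT); apply: le_trans.
rewrite le_eqVlt; apply/orP; left; apply/eqP.
by apply: eq_integral => y _; rewrite tshift0.
Qed.

(** By the triangle inequality, as [N ^+ 2] has mean [sigma]; the factor 2 enters [kappa]. *)
Let K2_abs : (gauss d).-integrable setT (EFin \o K2) /\
  \int[gauss d]_y (`|K2 y|)%:E <= (2 * sigma)%:E.
Proof.
have [i2 e] := standardized_dot2 (@gauss_standardized R d) v.
have iN : (gauss d).-integrable setT (EFin \o (fun y => rho ^+ 2 * dot v y ^+ 2)%R).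
  exact: integrable_scale.
have eN := integral_scale (rho ^+ 2) i2 e; rewrite -/sigma in eN.
have iK : (gauss d).-integrable setT (EFin \o K2).
  have := integrable_addr iN (integrable_cst (gauss d) (- sigma)).
  by apply: eq_integrable => // y _ /=; rewrite /K2 /N [in RHS]exprMn.
split => //.
have eS : \int[gauss d]_y (rho ^+ 2 * dot v y ^+ 2 + sigma)%:E = (sigma + sigma)%:E.
  apply: integral_add => //; first exact: integrable_cst.
  by rewrite integral_probability_cst.
rewrite mulr_natl mulr2n -eS; apply: ge0_le_integral => //.
- by apply/measurable_EFinP; exact: measurableT_comp.
- apply/measurable_EFinP; apply: measurable_funD => //; apply: measurable_funM => //.
  by apply: measurable_funX; exact: measurable_dot.
- move=> y _; rewrite lee_fin /K2 (le_trans (ler_normB _ _))//.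
  by rewrite (ger0_norm sigma0) ger0_norm ?sqr_ge0// /N [in leLHS]exprMn.
Qed.

(** The Lipschitz increment [a rho |v| = b |v|] times the bound [2 sigma] of [K2_abs]. *)
Let kappa := (2 * b ^+ 3 / a ^+ 2 * enorm v ^+ 3)%R.

Let g'_le s : (0 <= s <= 1)%R ->
  `|\int[gauss d]_y (g' s y)%:E| <= ((1 - s) * s * kappa)%:E.
Proof.
move=> s01; have /andP[s0 s1] := s01.
have [iK K2s] := K2_abs.
have v0 := enorm_ge0 v.
pose D y := ((1 - s) * ((H (tshift (s * rho) y v) - H y) * K2 y))%R.
have iD : (gauss d).-integrable setT (EFin \o (fun y => (H (tshift (s * rho) y v) - H y) * K2 y)%R).
  have := integrable_addr (iHK2 s01) (integrable_scale (-1) iHK).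
  by apply: eq_integrable => // y _ /=; rewrite mulrBl mulN1r.
(* Only the integrals agree, not the integrands: [cm_e2] moves the shift from the density into
   [H]. *)
have -> : \int[gauss d]_y (g' s y)%:E = \int[gauss d]_y (D y)%:E.
  have f1 : \int[gauss d]_y (H y * e2 s y)%:E \is a fin_num.
    exact: (integrable_fin_num measurableT (ie s01)).
  have f2 : \int[gauss d]_y (H y * K2 y)%:E \is a fin_num.
    exact: (integrable_fin_num measurableT iHK).
  have iK1 := integrable_scale (-1) iHK.
  have eK1 := integral_scale (-1) iHK (esym (fineK f2)).
  rewrite (integral_scale (1 - s) (integrable_addr (ie s01) iK1)
    (integral_add (ie s01) iK1 (esym (fineK f1)) eK1)).
  have f1' : \int[gauss d]_y (H (tshift (s * rho) y v) * K2 y)%:E =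
      (fine (\int[gauss d]_y (H y * e2 s y)%:E))%:E by rewrite fineK// cm_e2.
  rewrite -(integral_scale (1 - s) (integrable_addr (iHK2 s01) iK1)
    (integral_add (iHK2 s01) iK1 f1' eK1)).
  by apply: eq_integral => y _; rewrite /D mulN1r [(_ * K2 y)%R in RHS]mulrBl.
pose cc := ((1 - s) * (a * (s * rho) * enorm v))%R.
have cc0 : (0 <= cc)%R.
  have [aa rr] := (ltW a0, ltW rho0).
  by rewrite /cc mulr_ge0 ?subr_ge0// mulr_ge0// mulr_ge0// mulr_ge0.
have D_le y : (`|D y| <= cc * `|K2 y|)%R.
  rewrite /D /cc !normrM ger0_norm ?subr_ge0// -mulrA ler_wpM2l ?subr_ge0//.
  have rr := ltW rho0.
  by rewrite ler_wpM2r// (le_trans (H_shift _ _))// ger0_norm// mulr_ge0.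
have mD : measurable_fun setT D.
  apply: measurable_funM => //; apply: measurable_funM => //.
  apply: measurable_funB => //; apply: (measurableT_comp mH).
  exact: measurable_tshift.
apply: (@le_trans _ _ (\int[gauss d]_y (`|D y|)%:E)).
  by apply: le_abse_integral => //; exact/measurable_EFinP.
apply: (@le_trans _ _ (\int[gauss d]_y (cc%:E * (`|K2 y|)%:E))).
  apply: ge0_le_integral => //.
  - by apply/measurable_EFinP; exact: measurableT_comp.
  - apply: measurable_funeM; apply/measurable_EFinP; exact: measurableT_comp.
  - by move=> y _; rewrite -EFinM lee_fin.
rewrite ge0_integralZl//; last first.
  by apply/measurable_EFinP; exact: measurableT_comp.
apply: (@le_trans _ _ (cc%:E * (2 * sigma)%:E)).
  by apply: lee_wpmul2l.
rewrite -EFinM lee_fin /cc /kappa /sigma le_eqVlt; apply/orP; left; apply/eqP.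
by rewrite /rho; field; rewrite gt_eqF.
Qed.

Let int_kappa : \int[mu]_(s in `[0%R, 1%R]) ((1 - s) * s * kappa)%:E = (kappa / 6)%:E.
Proof.
have := @exppoly_FTC R 0%R 0%R (kappa *: (2^-1 *: 'X^2 - 3^-1 *: 'X^3))%R.
rewrite !horner0 !mul0r !add0r !(hornerZ, hornerD, hornerN, hornerXn).
rewrite (_ : (_ - _ = kappa / 6)%R); last by field.
move=> <-; apply: eq_integral => s _; congr EFin.
have -> : ((0 : {poly R})^`() = 0)%R by rewrite -polyC0 derivC.
rewrite addr0 horner0 mul0r add0r derivZ derivD derivN !derivZ !derivXn.
by rewrite !(hornerZ, hornerD, hornerN, hornerMn, hornerXn) /=; field.
Qed.

(** The Taylor coefficients are Gaussian moments of [H], as Gaussian integration by parts would give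
    for derivatives of the smoothed function; none of them depends on [v]. *)
Lemma gauss_avg_taylor_aux (c0 : R) (c : 'I_d -> R) (q : 'I_d -> 'I_d -> R) :
  \int[gauss d]_y (H y)%:E = c0%:E ->
  (forall j, \int[gauss d]_y (H y * tnth y j)%:E = (c j)%:E) ->
  (forall j k, \int[gauss d]_y (H y * (tnth y j * tnth y k))%:E = (q j k)%:E) ->
  (`|avg (gauss d) a h (tshift b x v) - (c0 + \sum_j (rho * c j) * tnth v j +
     \sum_j \sum_k (rho ^+ 2 / 2 * (q j k - (j == k)%:R * c0)) *
       (tnth v j * tnth v k))| <= b ^+ 3 / (3 * a ^+ 2) * enorm v ^+ 3)%R.
Proof.
move=> Hc0 Hc Hq.
have sq_le (y : d.-tuple R) : (enorm y <= 1 + enorm y ^+ 2)%R.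
  by have := sqr_ge0 (enorm y - 1)%R; have := enorm_ge0 y; nra.
have i0 : (gauss d).-integrable setT (EFin \o H).
  exact: (lip1_integrable _ _ (@gauss_standardized R d) hl).
have ij j : (gauss d).-integrable setT (EFin \o (fun y => H y * tnth y j)%R).
  apply: gauss_integrable_lip1M => //; first exact: measurable_tnth.
  by move=> y; exact: le_trans (norm_tnth_le y j) (sq_le y).
have ijk j k : (gauss d).-integrable setT (EFin \o (fun y => H y * (tnth y j * tnth y k))%R).
  apply: gauss_integrable_lip1M => //; first by apply: measurable_funM; exact: measurable_tnth.
  move=> y; apply: (@le_trans _ _ (enorm y ^+ 2)%R); last by rewrite lerDr.
  by rewrite normrM expr2 ler_pM// norm_tnth_le.
pose s0 := (rho ^+ 2 / 2 * (- enorm v ^+ 2))%R.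
have ia := integrable_bigsum (index_enum 'I_d) (fun j => integrable_scale (rho * tnth v j) (ij j)).
have ib := integrable_bigsum (index_enum 'I_d) (fun j => integrable_bigsum (index_enum 'I_d)
  (fun k => integrable_scale (rho ^+ 2 / 2 * (tnth v j * tnth v k)) (ijk j k))).
have ea := integral_bigsum (index_enum 'I_d) (fun j => integrable_scale (rho * tnth v j) (ij j))
  (fun j => integral_scale (rho * tnth v j) (ij j) (Hc j)).
have eb := integral_bigsum (index_enum 'I_d) (fun j => integrable_bigsum (index_enum 'I_d)
  (fun k => integrable_scale (rho ^+ 2 / 2 * (tnth v j * tnth v k)) (ijk j k)))
  (fun j => integral_bigsum (index_enum 'I_d)
    (fun k => integrable_scale (rho ^+ 2 / 2 * (tnth v j * tnth v k)) (ijk j k))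
    (fun k => integral_scale (rho ^+ 2 / 2 * (tnth v j * tnth v k)) (ijk j k) (Hq j k))).
have is0 := integrable_scale (1 + s0) i0.
have es0 := integral_scale (1 + s0) i0 Hc0.
have iab := integrable_addr (integrable_addr is0 ia) ib.
have eab := integral_add (integrable_addr is0 ia) ib (integral_add is0 ia es0 ea) eb.
have T2E y : ((1 + s0) * H y + \sum_j rho * tnth v j * (H y * tnth y j) +
    \sum_j \sum_k rho ^+ 2 / 2 * (tnth v j * tnth v k) * (H y * (tnth y j * tnth y k)) =
    H y * T2 y)%R.
  rewrite /T2 /K2 /N [in RHS]exprMn sqr_dot /dot /s0.
  transitivity (H y * (1 + s0) + H y * (rho * \sum_j tnth v j * tnth y j) +
    H y * (rho ^+ 2 / 2 * \sum_j \sum_k tnth v j * tnth v k * (tnth y j * tnth y k)))%R.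
    congr (_ + _ + _)%R; first by rewrite mulrC.
      by rewrite !mulr_sumr; apply: eq_bigr => j _; ring.
    rewrite !mulr_sumr; apply: eq_bigr => j _.
    by rewrite !mulr_sumr; apply: eq_bigr => k _; ring.
  by rewrite /s0 /sigma; field.
have iT : (gauss d).-integrable setT (EFin \o (fun y => H y * T2 y)%R).
  by apply: eq_integrable iab => // y _ /=; rewrite T2E.
set poly := (c0 + _ + _)%R.
have eT : \int[gauss d]_y (H y * T2 y)%:E = poly%:E.
  transitivity (\int[gauss d]_y ((1 + s0) * H y + \sum_j rho * tnth v j * (H y * tnth y j) +
    \sum_j \sum_k rho ^+ 2 / 2 * (tnth v j * tnth v k) * (H y * (tnth y j * tnth y k)))%:E).
    by apply: eq_integral => y _; rewrite T2E.
  rewrite eab; congr EFin; rewrite /poly.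
  have -> : (\sum_j \sum_k rho ^+ 2 / 2 * (q j k - (j == k)%:R * c0) * (tnth v j * tnth v k) =
    \sum_j \sum_k rho ^+ 2 / 2 * (tnth v j * tnth v k) * q j k + s0 * c0)%R.
    rewrite /s0 sqr_enorm mulrN mulNr mulr_sumr mulr_suml -sumrB; apply: eq_bigr => j _.
    rewrite [in RHS](_ : (rho ^+ 2 / 2 * tnth v j ^+ 2 * c0 =
      \sum_k rho ^+ 2 / 2 * ((j == k)%:R * c0) * (tnth v j * tnth v k))%R).
      by rewrite -sumrB; apply: eq_bigr => k _; ring.
    rewrite (bigD1 j)//= eqxx mul1r big1 ?addr0; first by ring.
    by move=> k kj; rewrite eq_sym (negbTE kj) mul0r mulr0 mul0r.
  have -> : (\sum_j rho * c j * tnth v j = \sum_j rho * tnth v j * c j)%R.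
    by apply: eq_bigr => j _; rewrite mulrAC.
  by ring.
have iE : (gauss d).-integrable setT (EFin \o (fun y => H y * cm_density rho v y)%R).
  have mHE : measurable_fun setT (fun y => H y * cm_density rho v y)%R.
    by apply: measurable_funM => //; exact: (@measurable_cm_density _ _ _ _ _ (fun=> rho) id).
  apply/integrableP; split; first exact/measurable_EFinP.
  have /integrableP[_] := lip1_integrable a (tshift b x v) (@gauss_standardized R d) hl.
  apply: le_lt_trans; rewrite le_eqVlt; apply/orP; left; apply/eqP.
  transitivity (\int[gauss d]_y ((`|H y|)%:E * (cm_density rho v y)%:E)).
    apply: eq_integral => y _; rewrite /= -EFinM normrM.
    by rewrite (ger0_norm (expR_ge0 _)).
  rewrite -cameron_martin; last by apply/measurable_EFinP; exact: measurableT_comp.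
  apply: eq_integral => y _ /=; rewrite /H tshiftA arho; congr (`|h _|%:E).
  by apply: eq_from_tnth => j; rewrite !tnth_tshift addrAC.
have eE : \int[gauss d]_y (H y * cm_density rho v y)%:E = (avg (gauss d) a h (tshift b x v))%:E.
  rewrite -avgE//; last exact: gauss_standardized.
  transitivity (\int[gauss d]_y ((H y)%:E * (cm_density rho v y)%:E)).
    by apply: eq_integral => y _; rewrite EFinM.
  rewrite -cameron_martin; last exact/measurable_EFinP.
  apply: eq_integral => y _ /=; rewrite /H tshiftA arho; congr ((h _)%:E).
  by apply: eq_from_tnth => j; rewrite !tnth_tshift addrAC.
have iT' := integrable_scale (-1) iT.
have eg := integral_add iE iT' eE (integral_scale (-1) iT eT).
rewrite mulN1r in eg.
have mk : measurable_fun setT (fun s : R => (1 - s) * s * kappa)%R.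
  by do 2 (apply: measurable_funM => //); exact: measurable_funB.
have := fubini01_le mg' g'M FTC mk g'_le.
rewrite int_kappa /g eg /= lee_fin => /le_trans; apply.
rewrite le_eqVlt; apply/orP; left; apply/eqP; rewrite /kappa.
by field; rewrite gt_eqF.
Qed.

End taylor.

(** * Replacing the law of a single step *)

Section lindeberg_step.
Context {R : realType} {d : nat}.
Local Open Scope ereal_scope.
Variables (h : d.-tuple R -> R) (a b : R) (x : d.-tuple R).
Hypotheses (hl : lip1 h) (a0 : (0 < a)%R) (b0 : (0 < b)%R).

(** The coefficients are fixed before [v], so that the polynomial can be integrated over [v] against
    any step law. *)
Lemma gauss_avg_taylor : exists (c0 : R) (c : 'I_d -> R) (q : 'I_d -> 'I_d -> R),
  forall v, (`|avg (gauss d) a h (tshift b x v) - (c0 + \sum_j c j * tnth v j +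
     \sum_j \sum_k q j k * (tnth v j * tnth v k))| <=
   b ^+ 3 / (3 * a ^+ 2) * enorm v ^+ 3)%R.
Proof.
pose H y := h (tshift a x y).
have fin (f : d.-tuple R -> R) : measurable_fun setT f ->
    (forall y, `|f y| <= 1 + enorm y ^+ 2)%R ->
    \int[gauss d]_y (H y * f y)%:E = (fine (\int[gauss d]_y (H y * f y)%:E))%:E.
  move=> mf f2; rewrite fineK//.
  exact: (integrable_fin_num measurableT (gauss_integrable_lip1M a x hl mf f2)).
have finj j := fin (fun y => tnth y j) (@measurable_tnth _ _ _ j).
have finjk j k := fin (fun y => tnth y j * tnth y k)%R
  (measurable_funM (@measurable_tnth _ _ _ j) (@measurable_tnth _ _ _ k)).
eexists; eexists; eexists => v.
apply: gauss_avg_taylor_aux => //.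
- exact: (avgE _ _ (@gauss_standardized R d) hl).
- move=> j; apply: finj => y; rewrite (le_trans (norm_tnth_le y j))//.
  by have := sqr_ge0 (enorm y - 1)%R; have := enorm_ge0 y; nra.
- move=> j k; apply: finjk => y; apply: (@le_trans _ _ (enorm y ^+ 2)%R); last by rewrite lerDr.
  by rewrite normrM expr2 ler_pM// norm_tnth_le.
Qed.

(** Each average is compared with the common value [c0 + \sum_j q j j] that [standardized_quad]
    assigns to the polynomial; each law pays its own third moment. *)
Lemma lindeberg_step (nu : probability (d.-tuple R) R) (m m' : R) :
  standardized nu ->
  \int[nu]_v (enorm v ^+ 3)%:E = m%:E ->
  \int[gauss d]_v (enorm v ^+ 3)%:E = m'%:E ->
  (`|avg nu b (avg (gauss d) a h) x - avg (gauss d) b (avg (gauss d) a h) x| <=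
   b ^+ 3 / (3 * a ^+ 2) * (m + m'))%R.
Proof.
move=> snu num gm.
have sg := @gauss_standardized R d.
have [c0 [c [q T]]] := gauss_avg_taylor.
set C := (b ^+ 3 / (3 * a ^+ 2))%R in T *.
have ul := avg_lip1 a sg hl.
suff dev (nu' : probability (d.-tuple R) R) n : standardized nu' ->
    \int[nu']_v (enorm v ^+ 3)%:E = n%:E ->
    (`|avg nu' b (avg (gauss d) a h) x - (c0 + \sum_j q j j)| <= C * n)%R.
  have := dev _ _ snu num; have := dev _ _ sg gm.
  rewrite !ler_norml mulrDr => /andP[? ?] /andP[? ?]; apply/andP; split; lra.
move=> snu' numn.
have [ip ep] := standardized_quad snu' c0 c q.
have iu := lip1_integrable b x snu' ul.
have [i3 _ _] := snu'.
have ip' := integrable_scale (-1) ip.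
have e := integral_add iu ip' (avgE b x snu' ul) (integral_scale (-1) ip ep).
rewrite mulN1r in e.
apply: (norm_integral_le (integrable_addr iu ip') (integrable_scale C i3) _ e).
  by move=> y; rewrite mulN1r; exact: T.
exact: integral_scale.
Qed.

(** The convolution identity for nonnegative functions is restated on the product law, a single
    measure to which [signed_transfer] applies with weight 1. *)
Lemma gauss_semigroup :
  avg (gauss d) b (avg (gauss d) a h) x = avg (gauss d) (Num.sqrt (a ^+ 2 + b ^+ 2)) h x.
Proof.
set c := Num.sqrt _.
have sg := @gauss_standardized R d.
have mh := lip1_measurable hl.
pose phi (p : d.-tuple R * d.-tuple R) := tshift a (tshift b x p.1) p.2.
have mphi : measurable_fun setT phi.
  by apply: measurable_tshift => //; exact: measurable_tshift.
have conv (f : d.-tuple R -> \bar R) : measurable_fun setT f -> (forall y, 0 <= f y) ->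
    \int[gauss d \x gauss d]_p f (phi p) = \int[gauss d]_y f (tshift c x y).
  move=> mf f0; rewrite (fubini_tonelli1 (fun p => f (phi p)))//; last first.
    exact: (measurableT_comp mf).
  by rewrite /fubini_F /phi/= /c addrC; exact: ge0_gauss_conv.
have conv' (f : d.-tuple R -> \bar R) : measurable_fun setT f ->
    \int[gauss d \x gauss d]_p f (phi p) = \int[gauss d]_y f (tshift c x y).
  move=> mf; have := @signed_transfer _ _ _ _ _ _ _ (gauss d \x gauss d) (gauss d) phi
    (tshift c x) (fun=> 1%R) (fun=> ler01) _ f mf.
  move=> -> //; first by apply: eq_integral => y _; rewrite mule1.
  move=> k mk k0; rewrite conv//.
  by apply: eq_integral => y _; rewrite mule1.
have ihphi : (gauss d \x gauss d).-integrable setT (fun p => (h (phi p))%:E).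
  apply/integrableP; split.
    by apply/measurable_EFinP; exact: (measurableT_comp mh).
  rewrite (conv (fun y => `|h y|%:E))//; last first.
    by apply/measurable_EFinP; exact: measurableT_comp.
  by have /integrableP[] := lip1_integrable c x sg hl.
have mEh : measurable_fun setT (EFin \o h) by exact/measurable_EFinP.
have := conv' _ mEh.
rewrite /= (avgE c x sg hl) => e.
rewrite {1}/avg -[RHS]/(fine (_%:E)) -e; congr fine.
rewrite -(integral12_prod_meas1 ihphi); apply: eq_integral => y _.
by rewrite -(avgE a _ sg hl).
Qed.

End lindeberg_step.

(** * Random walks with independent steps *)

Lemma rectangle_unique {R : realType} dT dU (T : measurableType dT)
    (U : measurableType dU) (m1 m2 : {measure set (T * U)%type -> \bar R}) :
  (forall A B, measurable A -> measurable B -> m1 (A `*` B) = m2 (A `*` B)) ->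
  (m1 setT < +oo)%E -> forall X, measurable X -> m1 X = m2 X.
Proof.
move=> m12 m1T X mX.
apply: (measure_unique [set A `*` B | A in measurable & B in measurable]
  (fun=> setT)) => //.
- exact: measurable_prod_measurableType.
- move=> _ _ [A1 mA1 [B1 mB1 <-]] [A2 mA2 [B2 mB2 <-]].
  exists (A1 `&` A2); first exact: measurableI.
  by exists (B1 `&` B2); [exact: measurableI|rewrite setXI].
- by move=> _; exists setT => //; exists setT => //; rewrite setXTT.
- by rewrite bigcup_const.
- by move=> _ [A mA [B mB <-]]; exact: m12.
Qed.

Section iid.
Context {R : realType} {dim : nat} d (T : measurableType d) (P : probability T R).
Local Open Scope ereal_scope.
Variables (xi : nat -> T -> dim.-tuple R) (c : R).
Hypotheses (mxi : forall i, measurable_fun setT (xi i))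
  (ind : mutually_independent P xi) (idd : identically_distributed P xi).

Let mX0 := isMeasurableFun.Build _ _ _ _ (xi 0%N) (mxi 0%N).
Let X0 : {mfun T >-> (dim.-tuple R)} := HB.pack (xi 0%N) mX0.
Definition xi_law : probability (dim.-tuple R) R := distribution P X0.
Local Notation nu := xi_law.

Fixpoint walk (k : nat) (w : T) : dim.-tuple R :=
  if k is k'.+1 then tshift c (walk k' w) (xi k' w) else [tuple 0%R | j < dim].

Lemma measurable_walk k : measurable_fun setT (walk k).
Proof. by elim: k => [|k IH] //=; exact: measurable_tshift. Qed.

Let mW k := isMeasurableFun.Build _ _ _ _ (walk k) (measurable_walk k).
Let W k : {mfun T >-> (dim.-tuple R)} := HB.pack (walk k) (mW k).
Let law k : probability (dim.-tuple R) R := distribution P (W k).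

Let pair k (w : T) := (walk k w, xi k w).
Let mpair k : measurable_fun setT (pair k).
Proof. by apply: measurable_fun_pair => //; exact: measurable_walk. Qed.
Let mPr k := isMeasurableFun.Build _ _ _ _ (pair k) (mpair k).
Let Pr k : {mfun T >-> (dim.-tuple R * dim.-tuple R)%type} := HB.pack (pair k) (mPr k).

Let mpre k A : measurable A -> measurable (xi k @^-1` A).
Proof. by move=> mA; rewrite -[X in measurable X]setTI; exact: mxi. Qed.

Let tail k m (C : nat -> set (dim.-tuple R)) : set T :=
  \bigcap_(i in `I_m) (xi (k + i)%N @^-1` C i).

Let mtail k m C : (forall i, measurable (C i)) -> measurable (tail k m C).
Proof.
by move=> mC; rewrite /tail bigcap_mkord; apply: bigsetI_measurable => i _; exact: mpre.
Qed.

Let tailS k m A C : tail k m.+1 (fun i => if i is i'.+1 then C i' else A) =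
  xi k @^-1` A `&` tail k.+1 m C.
Proof.
apply/seteqP; split => w /=.
  move=> H; split; first by have := H 0%N isT; rewrite /= addn0.
  by move=> i im; have := H i.+1 im; rewrite /= addnS addSn.
move=> [H0 H] [|i] im /=; first by rewrite addn0.
by have := H i im; rewrite addSn -addnS.
Qed.

Let pr m (C : nat -> set (dim.-tuple R)) := \prod_(i < m) nu (C i).

Let pr_ge0 m C : 0 <= pr m C.
Proof. by apply: prode_ge0 => i _; exact: measure_ge0. Qed.

Let pr_fin m C : (forall i, measurable (C i)) -> pr m C \is a fin_num.
Proof.
by move=> mC; apply: prode_fin_num => i _; exact: fin_num_measure.
Qed.

(** Independence of [walk k] from [xi k] alone would not propagate, so the induction carries all
    finite tails. The case [m.+1] at [k] is the product rule for rectangles of [(walk k, xi k)] on a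
    tail event; once extended to all measurable sets, it covers events about [walk k.+1]. *)
Let walk_indep_tail k : forall m A C, measurable A -> (forall i, measurable (C i)) ->
  P (walk k @^-1` A `&` tail k m C) = P (walk k @^-1` A) * pr m C.
Proof.
suff pairE k' : (forall m A C, measurable A -> (forall i, measurable (C i)) ->
    P (walk k' @^-1` A `&` tail k' m C) = P (walk k' @^-1` A) * pr m C) ->
    forall m C E, (forall i, measurable (C i)) -> measurable E ->
    P (pair k' @^-1` E `&` tail k'.+1 m C) = (law k' \x nu) E * pr m C.
  elim: k => [|k IH] m A C mA mC.
    have tE : P (tail 0 m C) = pr m C.
      rewrite /tail /= ind//; apply: eq_bigr => i _.
      exact: idd.
    have [zA|zA] := pselect (A [tuple 0%R | j < dim]).
      have -> : walk 0 @^-1` A = setT by apply/seteqP; split.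
      by rewrite setTI probability_setT mul1e.
    have -> : walk 0 @^-1` A = set0 by apply/seteqP; split.
    by rewrite set0I measure0 mul0e.
  pose E : set (dim.-tuple R * dim.-tuple R) := (fun p => tshift c p.1 p.2) @^-1` A.
  have mE : measurable E.
    rewrite -[X in measurable X]setTI.
    by apply: (measurable_tshift (measurable_cst c) measurable_fst measurable_snd).
  have H := pairE k IH.
  have -> : walk k.+1 @^-1` A = pair k @^-1` E by [].
  rewrite H//; congr (_ * _).
  have := H 0%N (fun=> setT) E (fun=> measurableT) mE.
  have -> : tail k.+1 0 (fun=> setT) = setT by apply/seteqP; split.
  by rewrite setIT /pr big_ord0 mule1.
move=> IH m C E mC mE.
have mt := mtail k'.+1 m mC.
(* The joint law restricted to the tail event: a finite measure, hence determined by its values on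
   rectangles. *)
pose Q := @measure_function_pushforward__canonical__measure_function_Measure
  _ _ _ _ _ (mrestr P mt) (pair k') (mpair k').
have p0 : (0 <= fine (pr m C))%R by rewrite fine_ge0.
pose Q' := mscale (NngNum p0) (law k' \x nu).
have rectE A B : measurable A -> measurable B -> Q (A `*` B) = Q' (A `*` B).
  move=> mA mB.
  transitivity (P (walk k' @^-1` A `&`
      tail k' m.+1 (fun i => if i is i'.+1 then C i' else B))).
    by rewrite tailS setIA.
  rewrite IH//; last by case.
  rewrite /Q' /mscale/= fineK ?pr_fin// (product_measure1E _ _ mA mB).
  by rewrite /pr big_ord_recl/= [LHS]muleA [LHS]muleC.
have -> : P (pair k' @^-1` E `&` tail k'.+1 m C) = Q E by [].
have QT : Q setT < +oo.
  rewrite -[Q setT]/(P (setT `&` tail k'.+1 m C)) setTI.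
  by rewrite (le_lt_trans (probability_le1 P mt))// ltry.
rewrite (rectangle_unique rectE QT mE).
transitivity ((fine (pr m C))%:E * (law k' \x nu) E); first by [].
by rewrite fineK ?pr_fin// muleC.
Qed.

Let pairE k E : measurable E -> P (pair k @^-1` E) = (law k \x nu) E.
Proof.
move=> mE.
have rectE A B : measurable A -> measurable B ->
    distribution P (Pr k) (A `*` B) = (law k \x nu) (A `*` B).
  move=> mA mB; rewrite product_measure1E//.
  have := @walk_indep_tail k 1%N A (fun=> B) mA (fun=> mB).
  rewrite /pr big_ord_recl big_ord0 mule1 => <-; congr (P _).
  apply/seteqP; split => w /=.
    by move=> [Aw Bw]; split => // -[|//] _; rewrite /= addn0.
  by move=> [Aw /(_ 0%N isT)]; rewrite /= addn0.
have fin : distribution P (Pr k) setT < +oo by rewrite probability_setT ltry.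
exact: (rectangle_unique rectE fin mE).
Qed.

Lemma walk_succ k (f : dim.-tuple R -> R) : measurable_fun setT f ->
  P.-integrable setT (EFin \o (f \o walk k.+1)) ->
  \int[P]_w (f (walk k.+1 w))%:E = \int[P]_w \int[nu]_v (f (tshift c (walk k w) v))%:E.
Proof.
move=> mf fi.
pose F (p : dim.-tuple R * dim.-tuple R) := (f (tshift c p.1 p.2))%:E.
have mF : measurable_fun setT F.
  apply/measurable_EFinP; apply: (measurableT_comp mf); exact: measurable_tshift.
have iF : (law k \x nu).-integrable setT F.
  apply/integrableP; split => //.
  have /integrableP[_] := fi; apply: le_lt_trans.
  rewrite le_eqVlt; apply/orP; left; apply/eqP.
  transitivity (\int[distribution P (Pr k)]_p `|F p|).
    by apply: eq_measure_integral => // E mE _; exact/esym/pairE.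
  by rewrite ge0_integral_distribution//; exact: measurableT_comp.
transitivity (\int[distribution P (Pr k)]_p F p).
  by rewrite integral_distribution.
transitivity (\int[law k \x nu]_p F p).
  by apply: eq_measure_integral => // E mE _; exact: pairE.
rewrite -(integral12_prod_meas1 iF) integral_distribution//.
- exact: (measurable_fubini_F iF).
- have := integrable_fubini_F iF.
  move=> /integrableP[m l]; apply/integrableP; split.
    by apply: (measurableT_comp m); exact: measurable_walk.
  move: l; rewrite ge0_integral_distribution//; exact: measurableT_comp.
Qed.

End iid.

(** * The Lindeberg exchange *)

Section harmonic.
Context {R : realType}.

Definition harm (n : nat) : R := \sum_(i < n) i.+1%:R^-1.

(** This is [ln (1 + x) <= x] at [x = - 1 / (n + 2)]. *)
Lemma ln_succ_diff n : (n.+2%:R^-1 <= ln n.+2%:R - ln n.+1%:R :> R).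
Proof.
have p1 : (n.+1%:R : R) \is Num.pos by rewrite posrE.
have p2 : (n.+2%:R : R) \is Num.pos by rewrite posrE.
rewrite -lerN2 opprB -ln_div//.
have -> : n.+1%:R / n.+2%:R = 1 + (- n.+2%:R^-1) :> R.
  have -> : n.+1%:R = n.+2%:R - 1 :> R by rewrite -(natr1 n.+1) addrK.
  have x0 : n.+2%:R != 0 :> R by rewrite pnatr_eq0.
  by move: x0; set x := n.+2%:R => x0; field.
by apply: le_ln1Dx; rewrite ltrN2 invf_lt1// ltr1n.
Qed.

Lemma ln_nat_ge0 n : 0 <= ln n.+1%:R :> R.
Proof. by rewrite ln_ge0// ler1n. Qed.

(** Since [1 / (n + 1) <= 2 / (n + 2)], each term is at most twice a logarithmic increment. The
    bound is exact for the empty sum, where [harm_le_1Dln] loses 1. *)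
Lemma harm_le_2ln n : harm n <= 2 * ln n.+1%:R.
Proof.
elim: n => [|n IH]; first by rewrite /harm big_ord0 ln1 mulr0.
rewrite /harm big_ord_recr/= -/(harm n).
have := ln_succ_diff n.
have : n.+1%:R^-1 <= 2 * n.+2%:R^-1 :> R.
  rewrite -[2]invrK -invfM lef_pV2 ?posrE ?mulr_gt0 ?invr_gt0//.
  rewrite mulrC ler_pdivrMr// -natrM ler_nat; lia.
move: IH; move: (harm n) (ln n.+1%:R) (ln n.+2%:R) n.+1%:R^-1 n.+2%:R^-1.
by move=> *; lra.
Qed.

Lemma harm_le_1Dln n : harm n <= 1 + ln n.+1%:R.
Proof.
have H : forall n, harm n.+1 <= 1 + ln n.+1%:R.
  elim=> [|m IH]; first by rewrite /harm big_ord_recl big_ord0 addr0 ln1 addr0 invr1.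
  rewrite /harm big_ord_recr/= -/(harm m.+1).
  have := ln_succ_diff m; move: IH.
  move: (harm m.+1) (ln m.+1%:R) (ln m.+2%:R) m.+2%:R^-1.
  by move=> *; lra.
case: n => [|n]; first by rewrite /harm big_ord0 addr_ge0// ln_nat_ge0.
rewrite (le_trans (H n))// lerD2l ler_ln ?posrE// ler_nat; lia.
Qed.

End harmonic.

(** * Telescoping over hybrid walks *)

Section lindeberg.
Context {R : realType} {dim : nat} d (T : measurableType d) (P : probability T R).
Local Open Scope ereal_scope.
Variables (xi : nat -> T -> dim.-tuple R) (n : nat).
Hypotheses (mxi : forall i, measurable_fun setT (xi i))
  (ind : mutually_independent P xi) (idd : identically_distributed P xi).
Hypothesis ixi : forall i, P.-integrable setT (EFin \o (fun w => enorm (xi i w))).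
Hypothesis n0 : (0 < n)%N.
Let c : R := (Num.sqrt n%:R)^-1.
Local Notation nu := (xi_law P mxi).
Local Notation gam := (@gauss R dim).
Hypothesis snu : standardized nu.
Variables (h : dim.-tuple R -> R) (e m3 e' m3' : R).
Hypothesis hl : lip1 h.
Hypotheses (nu1 : \int[nu]_v (enorm v)%:E = e%:E)
  (nu3 : \int[nu]_v (enorm v ^+ 3)%:E = m3%:E)
  (ga1 : \int[gam]_v (enorm v)%:E = e'%:E)
  (ga3 : \int[gam]_v (enorm v ^+ 3)%:E = m3'%:E).

Let sg := @gauss_standardized R dim.

Let c0 : (0 < c)%R.
Proof. by rewrite invr_gt0 sqrtr_gt0 ltr0n. Qed.

(** [m] counts the Gaussian steps still to come. The case [m = 0] is set apart because the semigroup
    and Taylor estimates ask for a positive smoothing scale. *)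
Let u (m : nat) : dim.-tuple R -> R :=
  if m is 0 then h else avg gam (Num.sqrt m%:R * c) h.

Let u_lip1 m : lip1 (u m).
Proof. by case: m => [//|m] /=; exact: avg_lip1. Qed.

Let u_succ m x : avg gam c (u m) x = u m.+1 x.
Proof.
case: m => [|m] /=; first by rewrite sqrtr1 mul1r.
rewrite gauss_semigroup//; last by rewrite mulr_gt0// sqrtr_gt0 ltr0n.
suff -> : (Num.sqrt ((Num.sqrt m.+1%:R * c) ^+ 2 + c ^+ 2) = Num.sqrt m.+2%:R * c)%R by [].
rewrite exprMn sqr_sqrtr// -[X in (_ + X)%R]mul1r -mulrDl natr1.
by rewrite sqrtrM// sqrtr_sqr gtr0_norm.
Qed.

Lemma avg_dist (nu' : probability (dim.-tuple R) R) (a r : R) f x :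
  standardized nu' -> lip1 f -> (0 <= a)%R -> \int[nu']_v (enorm v)%:E = r%:E ->
  (`|avg nu' a f x - f x| <= a * r)%R.
Proof.
move=> sn fl a0 nr.
have i1 := lip1_integrable a x sn fl; have i2 := integrable_cst nu' (- f x).
have ie := standardized_integrable_enorm sn.
have E : \int[nu']_t (f (tshift a x t) + - f x)%:E = (avg nu' a f x - f x)%:E.
  apply: integral_add => //; first exact: avgE.
  by rewrite integral_probability_cst.
apply: (norm_integral_le (integrable_addr i1 i2) (integrable_scale a ie) _ E).
  by move=> y /=; rewrite (le_trans (lip1_tshift_le _ _ _ fl))// ger0_norm.
exact: integral_scale.
Qed.

(** For [m > 0] the constant [b^3 / (3 a^2)] of [lindeberg_step] is taken at [a = sqrt m c] and
    [b = c]. *)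
Let delta (m : nat) : R :=
  if m is 0 then (c * (e + e'))%R else (c / (3 * m%:R) * (m3 + m3'))%R.

Let delta_step m x : (`|avg nu c (u m) x - u m.+1 x| <= delta m)%R.
Proof.
rewrite -u_succ; case: m => [|m].
  have /= := avg_dist x snu hl (ltW c0) nu1.
  have /= := avg_dist x sg hl (ltW c0) ga1.
  rewrite !ler_norml mulrDr => /andP[? ?] /andP[? ?]; apply/andP; split; lra.
have m0 : (0 < m.+1%:R :> R)%R by rewrite ltr0n.
have a0 : (0 < Num.sqrt m.+1%:R * c)%R by rewrite mulr_gt0// sqrtr_gt0.
have := lindeberg_step x hl a0 c0 snu nu3 ga3.
rewrite [X in (_ <= X * _)%R -> _](_ : _ = c / (3 * m.+1%:R))%R//.
rewrite exprMn sqr_sqrtr ?ltW//.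
by move: m0; set r := m.+1%:R%R => m0; field; rewrite !gt_eqF.
Qed.

Lemma walk_lip1_integrable k f : lip1 f ->
  P.-integrable setT (EFin \o (fun w => f (walk xi c k w))).
Proof.
move=> fl; elim: k => [|k IH] /=; first exact: integrable_cst.
have mf := lip1_measurable fl.
apply: (@integrable_le _ _ _ P _
  (fun w => `|f (walk xi c k w)| + `|c| * enorm (xi k w))%R).
- apply: (measurableT_comp mf); apply: measurable_tshift => //.
  exact: measurable_walk.
- apply: integrable_addr; last exact: integrable_scale.
  exact: (integrable_norm IH).
- by move=> w; exact: lip1_growth.
Qed.

(** The hybrid with [k] steps of the walk followed by [n - k] Gaussian ones: [A 0] is the Gaussian
    mean of [h], [A n] the mean of [h] at the normalized sum. *)
Let A k : R := fine (\int[P]_w (u (n - k) (walk xi c k w))%:E).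

Let AE k : \int[P]_w (u (n - k) (walk xi c k w))%:E = (A k)%:E.
Proof.
rewrite fineK//.
exact: (integrable_fin_num measurableT (walk_lip1_integrable k (@u_lip1 (n - k)))).
Qed.

(** Both hybrids start from the same [walk xi c k] and end with the same [u m]; only the law of the
    step in between differs. *)
Let A_step k : (k < n)%N -> (`|A k.+1 - A k| <= delta (n - k.+1))%R.
Proof.
move=> kn; set m := (n - k.+1)%N.
have nk : (n - k = m.+1)%N by rewrite /m subnSK.
have ul := @u_lip1 m.
have i1 := walk_lip1_integrable k (avg_lip1 c snu ul).
have i2 := walk_lip1_integrable k (@u_lip1 m.+1).
have i2' := integrable_scale (-1) i2.
have E1 : \int[P]_w (avg nu c (u m) (walk xi c k w))%:E = (A k.+1)%:E.
  rewrite -AE -/m (walk_succ mxi ind idd (lip1_measurable ul)); last first.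
    exact: walk_lip1_integrable.
  by apply: eq_integral => w _; rewrite (avgE _ _ snu ul).
have E2 : \int[P]_w (u m.+1 (walk xi c k w))%:E = (A k)%:E by rewrite -AE nk.
have E := integral_add i1 i2' E1 (integral_scale (-1) i2 E2).
rewrite mulN1r in E.
apply: (norm_integral_le (integrable_addr i1 i2') (integrable_cst P (delta m)) _ E).
  by move=> w; rewrite mulN1r; exact: delta_step.
by rewrite integral_probability_cst.
Qed.

Lemma lindeberg_bound :
  `|\int[gam]_y (h y)%:E - \int[P]_w (h (Snorm xi n w))%:E| <=
  (c * (e + e') + c / 3 * (m3 + m3') * harm n.-1)%:E.
Proof.
have An : \int[P]_w (h (Snorm xi n w))%:E = (A n)%:E.
  rewrite -AE subnn; apply: eq_integral => w _; congr (h _)%:E.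
  have walkE k j : tnth (walk xi c k w) j = ((\sum_(i < k) tnth (xi i w) j) * c)%R.
    elim: k => [|k IH] /=; first by rewrite tnth_mktuple big_ord0 mul0r.
    by rewrite tnth_tshift IH big_ord_recr/= mulrDl [(c * _)%R]mulrC.
  by apply: eq_from_tnth => j; rewrite walkE tnth_mktuple.
have A0 : \int[gam]_y (h y)%:E = (A 0)%:E.
  have nc : (Num.sqrt n%:R * c = 1)%R.
    by rewrite divff// gt_eqF// sqrtr_gt0 ltr0n.
  rewrite -AE subn0 (_ : u n = avg gam 1 h); last by rewrite -nc /u; case: (n) n0.
  rewrite /= integral_probability_cst -(avgE _ _ sg hl).
  apply: eq_integral => y _; congr (h _)%:E.
  by apply: eq_from_tnth => j; rewrite tnth_tshift tnth_mktuple mul1r add0r.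
rewrite A0 An -EFinB lee_fin distrC.
have tele : forall k, (k <= n)%N -> (`|A k - A 0| <= \sum_(i < k) delta (n - i.+1))%R.
  elim=> [|k IH] kn; first by rewrite subrr normr0 big_ord0.
  rewrite big_ord_recr/=; have := IH (ltnW kn); have := A_step kn.
  by rewrite !ler_norml => /andP[? ?] /andP[? ?]; apply/andP; split; lra.
apply: (le_trans (tele n (leqnn n))).
(* Read backwards, the sum is indexed by the Gaussian steps left. Index 0 is the unsmoothed
   exchange, which leaves [n.-1] terms for the harmonic sum. *)
rewrite (_ : (\sum_(i < n) delta (n - i.+1) = \sum_(i < n) delta i)%R); last first.
  rewrite (reindex_inj rev_ord_inj)/=; apply: eq_bigr => i _; congr delta.
  by have := ltn_ord i; lia.
case: (n) n0 => [//|n'] _; rewrite big_ord_recl/= lerD2l.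
rewrite /harm mulr_sumr ler_sum// => i _; rewrite /bump/= add1n.
rewrite le_eqVlt; apply/orP; left; apply/eqP.
have x0 : (i.+1%:R != 0 :> R)%R by rewrite pnatr_eq0.
by move: x0; set x := i.+1%:R%R => x0; field.
Qed.

End lindeberg.

(** Here [n.+1] is the number of steps. The terms in [e], [m3] and [e'] are compared separately;
    only the one in [e'], which also absorbs [m3'], is delicate. *)
Lemma constants_le {R : realType} (dim n : nat) (c e m3 e' m3' : R) :
  0 <= c -> 0 <= e -> 0 <= m3 -> 0 <= e' -> m3' <= (dim%:R + 2) * e' ->
  (dim = 0%N -> e' = 0) ->
  c * (e + e') + c / 3 * (m3 + m3') * harm n <=
  ((2 / 3 * dim%:R + 1) * e' + 1 / 3 * m3 + e) * (c * (1 + ln n.+1%:R)).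
Proof.
move=> c0 e0 m0 e'0 m3le dim0.
have l0 := @ln_nat_ge0 R n; have h1 := @harm_le_1Dln R n; have h2 := @harm_le_2ln R n.
have h0 : 0 <= harm n :> R by apply: sumr_ge0 => i _; rewrite invr_ge0.
set l := ln _ in l0 h1 h2 *; set H := harm n in h0 h1 h2 *.
have -> : c * (e + e') + c / 3 * (m3 + m3') * H =
  c * (e + m3 / 3 * H + (e' + m3' / 3 * H)) by field.
have -> : ((2 / 3 * dim%:R + 1) * e' + 1 / 3 * m3 + e) * (c * (1 + l)) =
  c * (e * (1 + l) + m3 / 3 * (1 + l) + (2 / 3 * dim%:R + 1) * (1 + l) * e') by field.
apply: ler_wpM2l => //; apply: lerD; first apply: lerD.
- by rewrite ler_peMr// lerDl.
- by rewrite ler_wpM2l// divr_ge0.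
apply: (@le_trans _ _ (e' + (dim%:R + 2) * e' / 3 * H)).
  by rewrite lerD2l ler_wpM2r// ler_pM2r// invr_gt0.
have -> : e' + (dim%:R + 2) * e' / 3 * H = (1 + (dim%:R + 2) / 3 * H) * e' by field.
(* The comparison of coefficients below uses [1 <= dim]; in dimension zero both sides carry the
   factor [e' = 0]. *)
have [d0|d1] := posnP dim; first by rewrite dim0// !mulr0.
apply: ler_wpM2r => //.
have D1 : 1 <= dim%:R :> R by rewrite ler1n.
set D := dim%:R in D1 *.
(* Two thirds of [h1] plus one third of [h2]. At [D = 1] these weights make the constant terms of
   the two sides equal, [1 + 2/3 = 5/3], whereas [h1] alone would require [l >= 1/2]. *)
have H3 : H <= (2 + 4 * l) / 3 by lra.
have : (D + 2) / 3 * H <= (D + 2) / 3 * ((2 + 4 * l) / 3).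
  by apply: ler_wpM2l => //; lra.
by nra.
Qed.

Theorem theorem3p3 (R : realType) (dim : nat)
  (d1 : measure_display) (T1 : measurableType d1) (P1 : probability T1 R)
  (B : T1 -> dim.-tuple R)
  (d : measure_display) (T : measurableType d) (P : probability T R)
  (xi : nat -> T -> dim.-tuple R) (n : nat) :
  std_gaussian_vector P1 B ->
  (forall i, measurable_fun setT (xi i)) ->
  mutually_independent P xi ->
  identically_distributed P xi ->
  (forall i (j : 'I_dim), ('E_P[fun w => tnth (xi i w) j] = 0)%E) ->
  (forall i (j k : 'I_dim),
     ('E_P[fun w => (tnth (xi i w) j * tnth (xi i w) k)%R] = ((j == k)%:R)%:E)%E) ->
  (exists M : R, forall i, (('E_P[fun w => (enorm (xi i w) ^+ 3)%R]) <= M%:E)%E) ->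
  (0 < n)%N ->
  (dW P1 B P (Snorm xi n) <=
     (((2 / 3 * dim%:R + 1)%:E * 'E_P1[fun w => enorm (B w)]
       + (1 / 3)%:E * 'E_P[fun w => (enorm (xi 0%N w) ^+ 3)%R]
       + 'E_P[fun w => enorm (xi 0%N w)])
      * ((Num.sqrt n%:R)^-1 * (1 + ln n%:R))%:E))%E.
Proof.
move=> gB mxi ind idd mean cov [M EM] n0.
have EE dU (U : measurableType dU) (Q : probability U R) (f : U -> R) :
  ('E_Q[f] = \int[Q]_w (f w)%:E)%E by rewrite unlock.
have i3 i : P.-integrable setT (EFin \o (fun w => enorm (xi i w) ^+ 3)).
  apply: (@ge0_integrable _ _ _ P _ M); last by rewrite -EE.
    by apply: measurable_funX; exact: measurable_enorm.
  by move=> w; rewrite exprn_ge0// enorm_ge0.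
have idom (i : nat) (f : dim.-tuple R -> R) : measurable_fun setT f ->
    (forall y, `|f y| <= 1 + enorm y ^+ 3) -> P.-integrable setT (EFin \o (f \o xi i)).
  move=> mf f3; apply: (@integrable_le _ _ _ P _ (fun w => 1 + enorm (xi i w) ^+ 3)).
  - exact: measurableT_comp.
  - by apply: integrable_addr => //; exact: integrable_cst.
  - by move=> w; exact: f3.
(* Cubic growth is what the third-moment bound controls; it covers all the moments that enter
   [standardized]. *)
have nuE (f : dim.-tuple R -> R) : measurable_fun setT f ->
    (forall y, `|f y| <= 1 + enorm y ^+ 3) ->
    (\int[xi_law P mxi]_y (f y)%:E = \int[P]_w (f (xi 0%N w))%:E)%E.
  move=> mf f3; rewrite integral_distribution//; first exact/measurable_EFinP.
  exact: (idom 0%N f).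
have b1 (y : dim.-tuple R) : `|enorm y| <= 1 + enorm y ^+ 3.
  by rewrite ger0_norm ?enorm_ge0//; have [] := le_1Dcube (enorm_ge0 y).
have b3 (y : dim.-tuple R) : `|enorm y ^+ 3| <= 1 + enorm y ^+ 3.
  by rewrite ger0_norm ?exprn_ge0 ?enorm_ge0// lerDr.
have me : measurable_fun setT (@enorm R dim) by exact: measurable_enorm.
have me3 : measurable_fun setT (fun y : dim.-tuple R => enorm y ^+ 3).
  exact: measurable_funX.
have bj j (y : dim.-tuple R) : `|tnth y j| <= 1 + enorm y ^+ 3.
  by rewrite (le_trans (norm_tnth_le y j))//; have [] := le_1Dcube (enorm_ge0 y).
have bjk j k (y : dim.-tuple R) : `|tnth y j * tnth y k| <= 1 + enorm y ^+ 3.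
  have [_] := le_1Dcube (enorm_ge0 y); apply: le_trans.
  by rewrite normrM expr2 ler_pM// norm_tnth_le.
have snu : standardized (xi_law P mxi).
  split.
  - have e3 := nuE _ me3 b3.
    apply: (@ge0_integrable _ _ _ (xi_law P mxi) _ M) => //.
      by move=> y; rewrite exprn_ge0// enorm_ge0.
    by rewrite e3 -EE.
  - by move=> j; rewrite (nuE (fun y => tnth y j)) -?EE//; exact: measurable_tnth.
  - move=> j k; rewrite (nuE (fun y => tnth y j * tnth y k)) -?EE//.
    by apply: measurable_funM; exact: measurable_tnth.
have sg := @gauss_standardized R dim.
have val (nu : probability (dim.-tuple R) R) : standardized nu ->
    exists e m3 : R, [/\ (\int[nu]_y (enorm y)%:E = e%:E)%E,
      (\int[nu]_y (enorm y ^+ 3)%:E = m3%:E)%E, 0 <= e & 0 <= m3].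
  move=> sn; have [j3 _ _] := sn; have j1 := standardized_integrable_enorm sn.
  exists (fine (\int[nu]_y (enorm y)%:E)%E), (fine (\int[nu]_y (enorm y ^+ 3)%:E)%E).
  split.
  - by rewrite fineK//; exact: (integrable_fin_num measurableT j1).
  - by rewrite fineK//; exact: (integrable_fin_num measurableT j3).
  - by rewrite fine_ge0// integral_ge0// => y _; rewrite lee_fin enorm_ge0.
  - by rewrite fine_ge0// integral_ge0// => y _; rewrite lee_fin exprn_ge0// enorm_ge0.
have [e [m3 [nu1 nu3 e0 m30]]] := val _ snu.
have [e' [m3' [ga1 ga3 e'0 m3'0]]] := val _ sg.
have m3'_le : m3' <= (dim%:R + 2) * e'.
  by have := @gauss_enorm3_le R dim; rewrite ga3 ga1 -EFinM lee_fin.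
have e'_dim0 : dim = 0%N -> e' = 0.
  move=> dim0; apply: EFin_inj; rewrite -ga1.
  transitivity (\int[gauss dim]_(y in setT) (0 : \bar R))%E; last exact: integral0.
  apply: eq_integral => y _; rewrite /enorm big1 ?sqrtr0// => j _.
  by exfalso; have := ltn_ord j; lia.
have EB : ('E_P1[fun w => enorm (B w)] = e'%:E)%E.
  rewrite EE -ga1 (ge0_integral_gaussian_vector gB (f := EFin \o @enorm R dim))//.
    exact/measurable_EFinP.
  by move=> y; rewrite lee_fin enorm_ge0.
have Exi1 : ('E_P[fun w => enorm (xi 0%N w)] = e%:E)%E by rewrite EE -nuE.
have Exi3 : ('E_P[fun w => (enorm (xi 0%N w) ^+ 3)%R] = m3%:E)%E.
  by rewrite EE -(nuE (fun y => enorm y ^+ 3)).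
rewrite EB Exi1 Exi3 -!EFinM.
apply: ge_ereal_sup => _ [h hl <-].
have ixi i : P.-integrable setT (EFin \o (fun w => enorm (xi i w))).
  exact: (idom i (@enorm R dim)).
have := lindeberg_bound ind idd ixi n0 snu hl nu1 nu3 ga1 ga3.
rewrite !EE /= (integral_gaussian_vector gB (f := EFin \o h)); last first.
  by apply/measurable_EFinP; exact: lip1_measurable.
move=> /le_trans; apply; rewrite lee_fin.
(* With [n = n'.+1], the [harm n.-1] of [lindeberg_bound] becomes [harm n'], in the indexing of
   [constants_le]. *)
case: n n0 => [//|n'] _; exact: constants_le.
Qed.
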